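(* Let $\varphi$ and $\omega$ be Schwarz-type functions and $F=\ell\circ\omega$. Suppose that at some point $\zeta$ of the unit circle, $\varphi$ has a radial limit of modulus one. If $T_{F,\varphi}(f)\in\mathcal{P}$ for every $f\in\mathcal{P}$, then $\omega$ does not have a finite non-zero angular derivative at $\zeta$.
   Context: $\mathbb{D}$ is the open unit disk. $\mathcal{P}$ is the set of analytic $f$ on $\mathbb{D}$ with $\mathrm{Re}\,f>0$ and $f(0)=1$. A Schwarz-type function is an analytic $\varphi:\mathbb{D}\to\mathbb{D}$ with $\varphi(0)=0$. $\ell(z)=\frac{1+z}{1-z}$. $T_{F,\varphi}(f)=F\cdot(f\circ\varphi)$. An analytic self-map $\omega$ of $\mathbb{D}$ has an angular derivative at $\zeta$ (in the sense of Carathéodory) if its nontangential limit at $\zeta$ has modulus one and $\omega'(z)$ has a finite nontangential limit as $z\to\zeta$. *)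

(* Defs.v *)
(* Stdlib reals + Coquelicot's complex numbers C.
   Complex differentiability uses Coquelicot's [ex_derive]/[is_derive]
   over the absolute ring [C_AbsRing] (absolute value = Cmod). *)
From Stdlib Require Import Reals.
From Coquelicot Require Import Coquelicot.
Open Scope R_scope.

Definition in_disk (z : C) : Prop := Cmod z < 1.

Definition analytic_on_disk (f : C -> C) : Prop :=
  forall z : C, in_disk z -> ex_derive f z.

Definition schwarz_type (phi : C -> C) : Prop :=
  analytic_on_disk phi /\ (forall z, in_disk z -> in_disk (phi z)) /\ phi 0%C = 0%C.

Definition class_P (f : C -> C) : Prop :=
  analytic_on_disk f /\ (forall z, in_disk z -> 0 < Re (f z)) /\ f 0%C = 1%C.

Definition ell (z : C) : C := ((1 + z) / (1 - z))%C.

Definition T_op (F phi f : C -> C) : C -> C := fun z => (F z * f (phi z))%C.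

Definition radial_limit (f : C -> C) (zeta L : C) : Prop :=
  forall eps : R, 0 < eps -> exists delta : R, 0 < delta /\
    forall r : R, 1 - delta < r -> r < 1 -> Cmod (f (RtoC r * zeta)%C - L) < eps.

(* nontangential limit of f at zeta equals L: f(z) -> L as z -> zeta
   within every Stolz angle {z in D : |zeta - z| <= M (1 - |z|)}, M > 1 *)
Definition nontangential_limit (f : C -> C) (zeta L : C) : Prop :=
  forall M : R, 1 < M -> forall eps : R, 0 < eps -> exists delta : R, 0 < delta /\
    forall z : C, in_disk z -> Cmod (z - zeta)%C < delta ->
      Cmod (zeta - z)%C <= M * (1 - Cmod z) -> Cmod (f z - L)%C < eps.

(* omega has a finite angular derivative equal to d at zeta (Caratheodory):
   the nontangential limit of omega at zeta has modulus one and omega'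
   has the finite nontangential limit d at zeta. *)
Definition angular_derivative (omega : C -> C) (zeta d : C) : Prop :=
  (exists eta : C, Cmod eta = 1 /\ nontangential_limit omega zeta eta) /\
  (exists domega : C -> C,
     (forall z, in_disk z -> is_derive omega z (domega z)) /\
     nontangential_limit domega zeta d).

(* Main.v *)
(** Testing the hypothesis on the rotations [f(z) = ell (lam z)] gives
    [4 |phi| |Im omega| <= (1 - |phi|^2) (1 - |omega|^2)] on the disk. At the points
    [z = zeta (1 - t (1 + i k))], with [k = 0, 1] and [t -> 0+], one has
    [|phi(z)| -> 1]: on the radius by assumption, and off it by Harnack's inequality
    for [Re (1 - conj L phi) >= 0], since these points stay at bounded hyperbolic
    distance from the radius. Hence [Im omega(z) = o(1 - |omega(z)|) = o(t)], whereas
    an angular derivative [d] gives [omega(z) = eta - d zeta t (1 + i k) + o(t)];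
    so [Im (d zeta (1 + i k)) = 0] for both [k], which forces [d = 0].

    Harnack's inequality comes from [r |g'(z)| <= 2 Re g(z)] when [Re g >= 0] on a disk
    of radius [r] about [z]. This in turn follows from one fact: if [Q] is continuous on
    a disk and differentiable off its center, and [Re Q >= 0] on the boundary circle, then
    [Re Q >= 0] at the center, because Goursat's theorem for [Q (exp (s + i t))] on
    rectangles makes the circular means of [Re Q] independent of the radius. *)
Require Import Defs.
From Stdlib Require Import Reals Lra Lia ClassicalEpsilon.
From Coquelicot Require Import Coquelicot.
Open Scope R_scope.

(** * Goursat's theorem on rectangles, in real coordinates *)

(** Differentiability of [u + i v] at one point, the derivative being multiplication by [A + i B].
    Nothing is said about how [A + i B] varies with the point, so the proof goes by Goursat's
    bisection rather than Green's formula. *)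
Definition CR_at (u v : R -> R -> R) (x0 y0 : R) : Prop :=
  exists A B : R, forall eps, 0 < eps -> exists delta, 0 < delta /\
    forall x y, Rabs (x - x0) < delta -> Rabs (y - y0) < delta ->
      Rabs (u x y - u x0 y0 - (A * (x - x0) - B * (y - y0)))
        <= eps * (Rabs (x - x0) + Rabs (y - y0)) /\
      Rabs (v x y - v x0 y0 - (B * (x - x0) + A * (y - y0)))
        <= eps * (Rabs (x - x0) + Rabs (y - y0)).

Definition CR_on (u v : R -> R -> R) (a b c d : R) : Prop :=
  forall x y, a <= x <= b -> c <= y <= d -> CR_at u v x y.

Lemma CR_on_sub u v a b c d a' b' c' d' :
  a <= a' -> b' <= b -> c <= c' -> d' <= d ->
  CR_on u v a b c d -> CR_on u v a' b' c' d'.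
Proof. intros; intros x y Hx Hy; apply H3; lra. Qed.

Lemma continuous_of_linear_bound (f : R -> R) (x0 K delta : R) :
  0 < delta ->
  (forall x, Rabs (x - x0) < delta -> Rabs (f x - f x0) <= K * Rabs (x - x0)) ->
  continuous f x0.
Proof.
  intros Hd H.
  apply continuity_pt_filterlim.
  intros eps Heps.
  assert (HK : 0 < Rabs K + 1) by (generalize (Rabs_pos K); lra).
  exists (Rmin delta (eps / (Rabs K + 1))). split.
  - apply Rmin_pos; [exact Hd|]. now apply Rdiv_lt_0_compat.
  - intros x [_ Hx]. unfold dist in *; simpl in *; unfold R_dist in *.
    assert (H1 := Rlt_le_trans _ _ _ Hx (Rmin_l _ _)).
    assert (H2 := Rlt_le_trans _ _ _ Hx (Rmin_r _ _)).
    specialize (H x H1).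
    assert (H3 : Rabs (x - x0) * (Rabs K + 1) < eps).
    { apply Rmult_lt_reg_r with (/ (Rabs K + 1)).
      - now apply Rinv_0_lt_compat.
      - replace (Rabs (x - x0) * (Rabs K + 1) * / (Rabs K + 1))
          with (Rabs (x - x0)) by (field; lra). exact H2. }
    generalize (Rle_abs K) (Rabs_pos (x - x0)). nra.
Qed.

Lemma CR_at_bound u v x0 y0 : CR_at u v x0 y0 ->
  exists K delta, 0 < delta /\
    forall x y, Rabs (x - x0) < delta -> Rabs (y - y0) < delta ->
      Rabs (u x y - u x0 y0) <= K * (Rabs (x - x0) + Rabs (y - y0)) /\
      Rabs (v x y - v x0 y0) <= K * (Rabs (x - x0) + Rabs (y - y0)).
Proof.
  intros (A & B & H). destruct (H 1 Rlt_0_1) as (delta & Hd & H').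
  exists (1 + Rabs A + Rabs B), delta. split; [exact Hd|].
  intros x y Hx Hy. destruct (H' x y Hx Hy) as [H1 H2].
  assert (E : forall p q r, Rabs (p - (q + r)) <= 1 * (Rabs (x - x0) + Rabs (y - y0)) ->
     Rabs q <= Rabs A * Rabs (x-x0) + Rabs B * Rabs (x-x0) ->
     Rabs r <= Rabs A * Rabs (y-y0) + Rabs B * Rabs (y-y0) ->
     Rabs p <= (1 + Rabs A + Rabs B) * (Rabs (x - x0) + Rabs (y - y0))).
  { intros p q r Hp Hq Hr.
    replace p with ((p - (q + r)) + (q + r)) by ring.
    eapply Rle_trans; [apply Rabs_triang|].
    generalize (Rabs_triang q r). lra. }
  generalize (Rabs_pos A) (Rabs_pos B) (Rabs_pos (x-x0)) (Rabs_pos (y-y0)); intros.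
  split.
  - apply (E _ (A * (x - x0)) (- (B * (y - y0)))).
    + exact H1.
    + rewrite Rabs_mult; nra.
    + rewrite Rabs_Ropp, Rabs_mult; nra.
  - apply (E _ (B * (x - x0)) (A * (y - y0))).
    + exact H2.
    + rewrite Rabs_mult; nra.
    + rewrite Rabs_mult; nra.
Qed.

(** Only these two slices matter: [circulation] integrates [u] along vertical sides and [v] along
    horizontal ones. *)
Lemma CR_at_continuous u v x0 y0 : CR_at u v x0 y0 ->
  continuous (fun y => u x0 y) y0 /\ continuous (fun x => v x y0) x0.
Proof.
  intros H. destruct (CR_at_bound _ _ _ _ H) as (K & delta & Hd & HK).
  split; apply continuous_of_linear_bound with K delta; try exact Hd.
  - intros y Hy. destruct (HK x0 y) as [H1 _].
    + rewrite Rminus_diag, Rabs_R0; exact Hd.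
    + exact Hy.
    + revert H1. rewrite Rminus_diag, Rabs_R0, Rplus_0_l. easy.
  - intros x Hx. destruct (HK x y0) as [_ H1].
    + exact Hx.
    + rewrite Rminus_diag, Rabs_R0; exact Hd.
    + revert H1. rewrite Rminus_diag, Rabs_R0, Rplus_0_r. easy.
Qed.

Lemma CR_on_ex_RInt u v a b c d : a <= b -> c <= d -> CR_on u v a b c d ->
  (forall x, a <= x <= b -> ex_RInt (fun y => u x y) c d) /\
  (forall y, c <= y <= d -> ex_RInt (fun x => v x y) a b).
Proof.
  intros Hab Hcd H. split.
  - intros x Hx. apply @ex_RInt_continuous. intros y Hy.
    rewrite Rmin_left, Rmax_right in Hy by assumption.
    apply (CR_at_continuous u v x y), H; lra.
  - intros y Hy. apply @ex_RInt_continuous. intros x Hx.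
    rewrite Rmin_left, Rmax_right in Hx by assumption.
    apply (CR_at_continuous u v x y), H; lra.
Qed.

(* The integral of [v dx + u dy] around the rectangle, that is, the imaginary
   part of the contour integral of [u + i v]. *)
Definition circulation (u v : R -> R -> R) (a b c d : R) : R :=
  RInt (fun x => v x c - v x d) a b + RInt (fun y => u b y - u a y) c d.

Lemma RInt_minus_split (f g h : R -> R) (a b : R) :
  ex_RInt f a b -> ex_RInt g a b -> ex_RInt h a b ->
  RInt (fun x => f x - h x) a b
  = RInt (fun x => f x - g x) a b + RInt (fun x => g x - h x) a b.
Proof.
  intros Hf Hg Hh.
  transitivity (RInt (fun x => plus (f x - g x) (g x - h x)) a b).
  - apply RInt_ext. intros x _. unfold plus; simpl; ring.
  - apply (RInt_plus (fun x => f x - g x) (fun x => g x - h x)); apply @ex_RInt_minus; assumption.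
Qed.

(** The integral of [u] over the common side [x = m] is added and subtracted; the horizontal sides
    concatenate. *)
Lemma circulation_split_x u v a m b c d :
  a <= m <= b -> c <= d -> CR_on u v a b c d ->
  circulation u v a b c d = circulation u v a m c d + circulation u v m b c d.
Proof.
  intros Hm Hcd H.
  destruct (CR_on_ex_RInt u v a m c d) as [U1 V1]; try lra.
  { apply (CR_on_sub u v a b c d); try lra; exact H. }
  destruct (CR_on_ex_RInt u v m b c d) as [U2 V2]; try lra.
  { apply (CR_on_sub u v a b c d); try lra; exact H. }
  unfold circulation.
  rewrite <- (RInt_Chasles (fun x => v x c - v x d) a m b).
  2: { apply @ex_RInt_minus; apply V1; lra. }
  2: { apply @ex_RInt_minus; apply V2; lra. }
  rewrite (RInt_minus_split (u b) (u m) (u a)) by (first [apply U1; lra | apply U2; lra]).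
  unfold plus; simpl; ring.
Qed.

Lemma circulation_split_y u v a b c m d :
  a <= b -> c <= m <= d -> CR_on u v a b c d ->
  circulation u v a b c d = circulation u v a b c m + circulation u v a b m d.
Proof.
  intros Hab Hm H.
  destruct (CR_on_ex_RInt u v a b c m) as [U1 V1]; try lra.
  { apply (CR_on_sub u v a b c d); try lra; exact H. }
  destruct (CR_on_ex_RInt u v a b m d) as [U2 V2]; try lra.
  { apply (CR_on_sub u v a b c d); try lra; exact H. }
  unfold circulation.
  rewrite <- (RInt_Chasles (fun y => u b y - u a y) c m d).
  2: { apply @ex_RInt_minus; apply U1; lra. }
  2: { apply @ex_RInt_minus; apply U2; lra. }
  rewrite (RInt_minus_split (fun x => v x c) (fun x => v x m) (fun x => v x d))
    by (first [apply V1; lra | apply V2; lra]).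
  unfold plus; simpl; ring.
Qed.

Lemma RInt_near_const (f : R -> R) (a b k e : R) :
  a <= b -> ex_RInt f a b -> (forall x, a <= x <= b -> Rabs (f x - k) <= e) ->
  Rabs (RInt f a b - k * (b - a)) <= e * (b - a).
Proof.
  intros Hab Hf H.
  assert (Hc : ex_RInt (fun _ : R => k) a b) by apply @ex_RInt_const.
  replace (RInt f a b - k * (b - a)) with (RInt (fun x => f x - k) a b).
  - rewrite (Rmult_comm e). apply abs_RInt_le_const; auto.
    apply @ex_RInt_minus; assumption.
  - rewrite (RInt_minus f (fun _ => k)) by assumption.
    rewrite RInt_const. unfold minus, plus, opp, scal; simpl; unfold mult; simpl. ring.
Qed.

(* Affine maps have zero circulation, so only the remainder contributes. *)
Lemma circulation_small u v x0 y0 : CR_at u v x0 y0 ->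
  forall eps, 0 < eps -> exists delta, 0 < delta /\
    forall a b c d, a <= x0 <= b -> c <= y0 <= d -> b - a < delta -> d - c < delta ->
      CR_on u v a b c d ->
      Rabs (circulation u v a b c d) <= eps * (b - a + (d - c)) ^ 2.
Proof.
  intros (A & B & H) eps Heps.
  destruct (H (eps / 2)) as (delta & Hd & H'); [lra|].
  exists delta. split; [exact Hd|].
  intros a b c d Hx Hy Hab Hcd Hon.
  destruct (CR_on_ex_RInt u v a b c d) as [U V]; try lra; try exact Hon.
  assert (E : forall x y, a <= x <= b -> c <= y <= d ->
    Rabs (u x y - u x0 y0 - (A * (x - x0) - B * (y - y0)))
        <= eps / 2 * (b - a + (d - c)) /\
    Rabs (v x y - v x0 y0 - (B * (x - x0) + A * (y - y0)))
        <= eps / 2 * (b - a + (d - c))).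
  { intros x y Hx' Hy'.
    assert (Dx : Rabs (x - x0) <= b - a) by (apply Rabs_le; lra).
    assert (Dy : Rabs (y - y0) <= d - c) by (apply Rabs_le; lra).
    destruct (H' x y) as [H1 H2]; try lra.
    split; (eapply Rle_trans; [eassumption|]); apply Rmult_le_compat_l; lra. }
  (* The affine part contributes [- A (d - c)] to the integrand on the horizontal sides and
     [A (b - a)] on the vertical ones; after integration these main terms cancel. *)
  assert (I1 : Rabs (RInt (fun x => v x c - v x d) a b - (- A * (d - c)) * (b - a))
             <= eps * (b - a + (d - c)) * (b - a)).
  { apply RInt_near_const; [lra| |].
    - apply @ex_RInt_minus; apply V; lra.
    - intros x Hx'.
      destruct (E x c) as [_ E1]; try lra. destruct (E x d) as [_ E2]; try lra.
      apply Rabs_le_between in E1. apply Rabs_le_between in E2. apply Rabs_le. lra. }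
  assert (I2 : Rabs (RInt (fun y => u b y - u a y) c d - (A * (b - a)) * (d - c))
             <= eps * (b - a + (d - c)) * (d - c)).
  { apply RInt_near_const; [lra| |].
    - apply @ex_RInt_minus; apply U; lra.
    - intros y Hy'.
      destruct (E a y) as [E1 _]; try lra. destruct (E b y) as [E2 _]; try lra.
      apply Rabs_le_between in E1. apply Rabs_le_between in E2. apply Rabs_le. lra. }
  unfold circulation.
  apply Rabs_le_between in I1. apply Rabs_le_between in I2. apply Rabs_le. nra.
Qed.

(** The left ends increase and the right ends decrease, so the supremum of the left ends lies in
    every interval. *)
Lemma nested_dyadic (a : nat -> R) (W : R) : 0 <= W ->
  (forall n, a n <= a (S n) <= a n + W / 2 ^ S n) ->
  exists p, forall n, a n <= p <= a n + W / 2 ^ n.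
Proof.
  intros HW H.
  assert (Hp : forall n, 0 < 2 ^ n) by (intro n; apply pow_lt; lra).
  assert (Hh : forall n, W / 2 ^ n = 2 * (W / 2 ^ S n)).
  { intro n. simpl. field. generalize (Hp n); lra. }
  assert (Hpos : forall n, 0 <= W / 2 ^ n).
  { intro n. apply Rmult_le_pos; [exact HW|]. left; apply Rinv_0_lt_compat, Hp. }
  assert (mono : forall n k, a n <= a (n + k)%nat /\
      a (n + k)%nat + W / 2 ^ (n + k) <= a n + W / 2 ^ n).
  { intros n k. induction k as [|k IH].
    - rewrite Nat.add_0_r. lra.
    - rewrite <- plus_n_Sm. specialize (H (n + k)%nat). specialize (Hh (n + k)%nat).
      specialize (Hpos (S (n + k))). lra. }
  assert (ub : forall m n, a m <= a n + W / 2 ^ n).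
  { intros m n. destruct (Nat.le_ge_cases m n) as [h|h].
    - replace n with (m + (n - m))%nat by lia.
      destruct (mono m (n - m)%nat). specialize (Hpos (m + (n - m))%nat). lra.
    - replace m with (n + (m - n))%nat by lia.
      destruct (mono n (m - n)%nat). specialize (Hpos (n + (m - n))%nat). lra. }
  destruct (completeness (fun x => exists m, x = a m)) as [p [P1 P2]].
  - exists (a 0%nat + W / 2 ^ 0). intros x [m ->]. apply ub.
  - exists (a 0%nat), 0%nat. reflexivity.
  - exists p. intro n. split.
    + apply P1. now exists n.
    + apply P2. intros x [m ->]. apply ub.
Qed.

(** The circulations of the four quarters add up to that of the whole, so one of them has at least a
    quarter of its absolute value. *)
Lemma circulation_quarter u v a c w h :
  0 <= w -> 0 <= h -> CR_on u v a (a + w) c (c + h) ->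
  exists a' c', a <= a' <= a + w / 2 /\ c <= c' <= c + h / 2 /\
    Rabs (circulation u v a (a + w) c (c + h)) / 4 <=
    Rabs (circulation u v a' (a' + w / 2) c' (c' + h / 2)).
Proof.
  intros Hw Hh H.
  rewrite (circulation_split_x u v a (a + w / 2)) by (try lra; exact H).
  rewrite (circulation_split_y u v a (a + w / 2) c (c + h / 2)).
  2, 3: lra.
  2: { apply (CR_on_sub u v a (a + w) c (c + h)); try lra; exact H. }
  rewrite (circulation_split_y u v (a + w / 2) (a + w) c (c + h / 2)).
  2, 3: lra.
  2: { apply (CR_on_sub u v a (a + w) c (c + h)); try lra; exact H. }
  replace (a + w) with (a + w / 2 + w / 2) by field.
  replace (c + h) with (c + h / 2 + h / 2) by field.
  set (I1 := circulation u v a (a + w / 2) c (c + h / 2)).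
  set (I2 := circulation u v a (a + w / 2) (c + h / 2) (c + h / 2 + h / 2)).
  set (I3 := circulation u v (a + w / 2) (a + w / 2 + w / 2) c (c + h / 2)).
  set (I4 := circulation u v (a + w / 2) (a + w / 2 + w / 2) (c + h / 2) (c + h / 2 + h / 2)).
  set (T := Rabs (I1 + I2 + (I3 + I4))).
  assert (HT : T <= Rabs I1 + Rabs I2 + (Rabs I3 + Rabs I4)).
  { unfold T. eapply Rle_trans; [apply Rabs_triang|].
    generalize (Rabs_triang I1 I2) (Rabs_triang I3 I4). lra. }
  destruct (Rle_dec (T / 4) (Rabs I1)) as [h1|h1].
  { exists a, c. split; [lra|split; [lra|exact h1]]. }
  destruct (Rle_dec (T / 4) (Rabs I2)) as [h2|h2].
  { exists a, (c + h / 2). split; [lra|split; [lra|exact h2]]. }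
  destruct (Rle_dec (T / 4) (Rabs I3)) as [h3|h3].
  { exists (a + w / 2), c. split; [lra|split; [lra|exact h3]]. }
  exists (a + w / 2), (c + h / 2). split; [lra|split; [lra|]]. fold I4. lra.
Qed.

Lemma goursat_rectangle u v a b c d :
  a <= b -> c <= d -> CR_on u v a b c d -> circulation u v a b c d = 0.
Proof.
  intros Hab Hcd Hon.
  set (W := b - a). set (H := d - c).
  assert (HW : 0 <= W) by (unfold W; lra).
  assert (HH : 0 <= H) by (unfold H; lra).
  assert (Hp : forall n, 0 < 2 ^ n) by (intro n; apply pow_lt; lra).
  assert (Hdiv : forall X n, X / 2 ^ S n = X / 2 ^ n / 2).
  { intros X n. simpl. field. generalize (Hp n); lra. }
  assert (Hpos : forall X n, 0 <= X -> 0 <= X / 2 ^ n).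
  { intros X n HX. apply Rmult_le_pos; [exact HX|]. left; apply Rinv_0_lt_compat, Hp. }
  set (good := fun (n : nat) (p : R * R) =>
    CR_on u v (fst p) (fst p + W / 2 ^ n) (snd p) (snd p + H / 2 ^ n)).
  set (I := fun (n : nat) (p : R * R) =>
    circulation u v (fst p) (fst p + W / 2 ^ n) (snd p) (snd p + H / 2 ^ n)).
  (* The implication from [good] makes the claim hold for every pair, with a dummy witness when it
     fails; choice then yields a total function [f] to iterate. *)
  assert (Hex : forall np : nat * (R * R), exists q : R * R,
    let (n, p) := np in good n p ->
      fst p <= fst q <= fst p + W / 2 ^ S n /\
      snd p <= snd q <= snd p + H / 2 ^ S n /\
      Rabs (I n p) / 4 <= Rabs (I (S n) q)).
  { intros [n p].
    destruct (classic (good n p)) as [G|G].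
    - destruct (circulation_quarter u v (fst p) (snd p) (W / 2 ^ n) (H / 2 ^ n))
        as (a' & c' & h1 & h2 & h3); auto.
      exists (a', c'). intros _. unfold I; simpl fst; simpl snd. rewrite !Hdiv. auto.
    - exists p. intro; contradiction. }
  set (f := fun np : nat * (R * R) =>
    proj1_sig (constructive_indefinite_description _ (Hex np))).
  assert (Hf := fun np : nat * (R * R) =>
    proj2_sig (constructive_indefinite_description _ (Hex np))).
  change (forall np : nat * (R * R), let (n, p) := np in good n p ->
      fst p <= fst (f np) <= fst p + W / 2 ^ S n /\
      snd p <= snd (f np) <= snd p + H / 2 ^ S n /\
      Rabs (I n p) / 4 <= Rabs (I (S n) (f np))) in Hf.
  set (p := fix p n := match n with O => (a, c) | S m => f (m, p m) end).
  assert (G : forall n, good n (p n)).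
  { induction n as [|n IH].
    - unfold good; simpl. apply (CR_on_sub u v a b c d); try exact Hon; unfold W, H; lra.
    - destruct (Hf (n, p n) IH) as (h1 & h2 & _).
      unfold good in *; change (p (S n)) with (f (n, p n)).
      revert h1 h2. rewrite !Hdiv. intros.
      eapply CR_on_sub; [| | | |exact IH]; try lra. }
  assert (Q : forall n, Rabs (circulation u v a b c d) / 4 ^ n <= Rabs (I n (p n))).
  { induction n as [|n IH].
    - unfold I; simpl. right. rewrite !Rdiv_1_r. unfold W, H.
      f_equal. f_equal; ring.
    - destruct (Hf (n, p n) (G n)) as (_ & _ & h).
      change (p (S n)) with (f (n, p n)). eapply Rle_trans; [|exact h].
      replace (Rabs (circulation u v a b c d) / 4 ^ S n)
        with (Rabs (circulation u v a b c d) / 4 ^ n / 4).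
      + lra.
      + simpl. field. apply pow_nonzero; lra. }
  destruct (nested_dyadic (fun n => fst (p n)) W HW) as [x0 Hx0].
  { intro n. apply (Hf (n, p n) (G n)). }
  destruct (nested_dyadic (fun n => snd (p n)) H HH) as [y0 Hy0].
  { intro n. apply (Hf (n, p n) (G n)). }
  assert (CR0 : CR_at u v x0 y0).
  { apply (G 0%nat); [apply (Hx0 0%nat)|apply (Hy0 0%nat)]. }
  apply Rabs_eq_0. apply Rle_antisym; [|apply Rabs_pos].
  apply le_epsilon. intros eps Heps. rewrite Rplus_0_l.
  (* At level [n] the circulation is at least [1 / 4 ^ n] of the original in absolute value, and at
     most [e ((W + H) / 2 ^ n) ^ 2]; the powers cancel. The [+ 1] keeps the denominator positive for
     a degenerate rectangle. *)
  set (e := eps / ((W + H) ^ 2 + 1)).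
  assert (HD : 0 < (W + H) ^ 2 + 1) by nra.
  assert (He : 0 < e) by (unfold e; now apply Rdiv_lt_0_compat).
  destruct (circulation_small u v x0 y0 CR0 e He) as (delta & Hd & HS).
  assert (Hn : exists n, W / 2 ^ n < delta /\ H / 2 ^ n < delta).
  { destruct (nfloor_ex ((W + H) / delta)) as [N [_ HN]].
    { apply Rmult_le_pos; [lra|]. left; now apply Rinv_0_lt_compat. }
    exists (S N).
    assert (B : (W + H) / 2 ^ S N < delta).
    { apply Rmult_lt_reg_r with (2 ^ S N); [apply Hp|].
      replace ((W + H) / 2 ^ S N * 2 ^ S N) with (W + H)
        by (field; generalize (Hp (S N)); lra).
      apply Rlt_le_trans with (delta * INR (S N)).
      - rewrite S_INR. apply Rmult_lt_reg_r with (/ delta); [now apply Rinv_0_lt_compat|].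
        replace (delta * (INR N + 1) * / delta) with (INR N + 1) by (field; lra). exact HN.
      - apply Rmult_le_compat_l; [lra|].
        left. apply Rlt_le_trans with (2 ^ S N); [|lra].
        clear. induction (S N) as [|k IH]; [simpl; lra|].
        rewrite S_INR. simpl. generalize (pow_R1_Rle 2 k). lra. }
    assert (E : (W + H) / 2 ^ S N = W / 2 ^ S N + H / 2 ^ S N) by (unfold Rdiv; ring).
    generalize (Hpos W (S N) HW) (Hpos H (S N) HH). lra. }
  destruct Hn as [n [n1 n2]].
  specialize (HS (fst (p n)) (fst (p n) + W / 2 ^ n) (snd (p n)) (snd (p n) + H / 2 ^ n)
    (Hx0 n) (Hy0 n)).
  assert (B := Rle_trans _ _ _ (Q n) (HS ltac:(lra) ltac:(lra) (G n))).
  assert (P4 : 0 < 4 ^ n) by (apply pow_lt; lra).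
  apply Rmult_le_compat_r with (r := 4 ^ n) in B; [|lra].
  replace (Rabs (circulation u v a b c d) / 4 ^ n * 4 ^ n)
    with (Rabs (circulation u v a b c d)) in B by (field; lra).
  eapply Rle_trans; [exact B|].
  replace (4 ^ n) with (2 ^ n * 2 ^ n) by (rewrite <- Rpow_mult_distr; f_equal; ring).
  replace (e * _ ^ 2 * _) with (e * (W + H) ^ 2).
  - apply Rle_trans with (e * ((W + H) ^ 2 + 1)); [nra|].
    right. unfold e. field. lra.
  - simpl. field. generalize (Hp n); lra.
Qed.

(** * Complex differentiation in epsilon-delta form *)

Lemma is_derive_C_eps (f : C -> C) (z l : C) :
  is_derive f z l <->
  forall eps, 0 < eps -> exists delta, 0 < delta /\ forall w,
    Cmod (w - z) < delta -> Cmod (f w - f z - l * (w - z)) <= eps * Cmod (w - z).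
Proof.
  split.
  - intros [_ H] eps Heps.
    destruct (H z (fun P HP => HP) (mkposreal eps Heps)) as [delta Hd].
    exists delta. split; [apply cond_pos|].
    intros w Hw. rewrite (Cmult_comm l). exact (Hd w Hw).
  - intros H. split.
    + apply is_linear_scal_l.
    + intros x Hx.
      apply (is_filter_lim_locally_unique (V := AbsRing_NormedModule C_AbsRing)) in Hx. subst x.
      intros eps. destruct (H eps (cond_pos eps)) as (delta & Hd & Hw).
      exists (mkposreal delta Hd). intros w Hb.
      specialize (Hw w Hb). rewrite (Cmult_comm l) in Hw. exact Hw.
Qed.

(* Coquelicot has two normed modules on [C]: over itself as an absolute ring,
   and the one with the product uniform structure used by [C -> C] by default. *)
Lemma is_derive_C_AbsRing (f : C -> C) (z l : C) :
  is_derive (K := C_AbsRing) (V := AbsRing_NormedModule C_AbsRing) f z l <->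
  is_derive (K := C_AbsRing) (V := C_NormedModule) f z l.
Proof.
  split; intros [_ H]; (split; [apply is_linear_scal_l|exact H]).
Qed.

Lemma is_derive_C_const (c z : C) : is_derive (fun _ => c) z (0 : C).
Proof. apply (is_derive_const (K := C_AbsRing) (V := C_NormedModule)). Qed.

Lemma is_derive_C_id (z : C) : is_derive (fun w : C => w) z (1 : C).
Proof. apply is_derive_C_AbsRing, (is_derive_id (K := C_AbsRing)). Qed.

Lemma is_derive_C_plus (f g : C -> C) (z df dg : C) :
  is_derive f z df -> is_derive g z dg -> is_derive (fun w => f w + g w)%C z (df + dg)%C.
Proof. apply (is_derive_plus (K := C_AbsRing) (V := C_NormedModule)). Qed.

Lemma is_derive_C_mult (f g : C -> C) (z df dg : C) :
  is_derive f z df -> is_derive g z dg ->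
  is_derive (fun w => f w * g w)%C z (df * g z + f z * dg)%C.
Proof.
  intros Hf Hg.
  apply is_derive_C_AbsRing.
  apply (is_derive_mult (K := C_AbsRing) f g z df dg);
    [now apply is_derive_C_AbsRing|now apply is_derive_C_AbsRing|apply Cmult_comm].
Qed.

Lemma is_derive_C_comp (f g : C -> C) (z df dg : C) :
  is_derive f (g z) df -> is_derive g z dg -> is_derive (fun w => f (g w)) z (dg * df)%C.
Proof.
  intros Hf Hg.
  apply (is_derive_comp (K := C_AbsRing) (V := C_NormedModule) f g z df dg Hf).
  now apply is_derive_C_AbsRing.
Qed.

Lemma im_le_Cmod (c : C) : Rabs (Im c) <= Cmod c.
Proof. eapply Rle_trans; [apply Rmax_r|apply Rmax_Cmod]. Qed.

Lemma Cmod_le_sum (x y : R) : Cmod (x, y) <= Rabs x + Rabs y.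
Proof.
  replace ((x, y) : C) with (RtoC x + RtoC y * Ci)%C.
  - eapply Rle_trans; [apply Cmod_triangle|].
    rewrite Cmod_mult, Cmod_Ci, !Cmod_R. lra.
  - unfold RtoC, Ci, Cplus, Cmult; simpl. f_equal; ring.
Qed.

Lemma is_derive_C_lipschitz (f : C -> C) (z l : C) : is_derive f z l ->
  exists K delta, 0 < K /\ 0 < delta /\ forall w, Cmod (w - z) < delta ->
    Cmod (f w - f z) <= K * Cmod (w - z).
Proof.
  intros H. apply is_derive_C_eps with (eps := 1) in H; [|lra].
  destruct H as (delta & Hd & H).
  exists (1 + Cmod l), delta. split; [generalize (Cmod_ge_0 l); lra|].
  split; [exact Hd|]. intros w Hw. specialize (H w Hw).
  replace (f w - f z)%C with ((f w - f z - l * (w - z)) + l * (w - z))%C by ring.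
  eapply Rle_trans; [apply Cmod_triangle|]. rewrite Cmod_mult. lra.
Qed.

Lemma is_derive_C_continuous (f : C -> C) (z l : C) : is_derive f z l ->
  forall eps, 0 < eps -> exists delta, 0 < delta /\ forall w, Cmod (w - z) < delta ->
    Cmod (f w - f z) < eps.
Proof.
  intros H eps Heps.
  destruct (is_derive_C_lipschitz f z l H) as (K & delta & HK & Hd & HL).
  exists (Rmin delta (eps / K)). split.
  - apply Rmin_pos; [exact Hd|]. now apply Rdiv_lt_0_compat.
  - intros w Hw. eapply Rle_lt_trans.
    + apply HL. eapply Rlt_le_trans; [exact Hw|apply Rmin_l].
    + apply Rlt_le_trans with (K * (eps / K)).
      * apply Rmult_lt_compat_l; [exact HK|].
        eapply Rlt_le_trans; [exact Hw|apply Rmin_r].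
      * right; field; lra.
Qed.

(** The remainder is exactly [(w - z)^2 / (w z^2)], and [|w| > |z| / 2] bounds the modulus of its
    denominator below by [k = |z|^3 / 2]. *)
Lemma is_derive_C_inv (z : C) : z <> 0 -> is_derive Cinv z (- / (z * z))%C.
Proof.
  intros Hz. apply is_derive_C_eps. intros eps Heps.
  assert (Hm : 0 < Cmod z) by now apply Cmod_gt_0.
  set (m := Cmod z) in *.
  set (k := m * m * m / 2).
  assert (Hk : 0 < k).
  { unfold k. apply Rdiv_lt_0_compat; [repeat apply Rmult_lt_0_compat; lra|lra]. }
  exists (Rmin (m / 2) (eps * k)). split.
  { apply Rmin_pos; [lra|]. now apply Rmult_lt_0_compat. }
  intros w Hw.
  assert (H1 := Rlt_le_trans _ _ _ Hw (Rmin_l _ _)).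
  assert (H2 := Rlt_le_trans _ _ _ Hw (Rmin_r _ _)).
  assert (Hwm : m / 2 < Cmod w).
  { assert (m <= Cmod w + Cmod (w - z)); [|lra].
    unfold m. replace z with (w + - (w - z))%C at 1 by ring.
    rewrite <- (Cmod_opp (w - z)). apply Cmod_triangle. }
  assert (Hw0 : w <> 0).
  { intro E. rewrite E, Cmod_0 in Hwm. lra. }
  replace (/ w - / z - - / (z * z) * (w - z))%C
    with ((w - z) * (w - z) / (w * (z * z)))%C by (field; split; assumption).
  rewrite Cmod_div by (repeat apply Cmult_neq_0; assumption).
  rewrite !Cmod_mult. fold m.
  assert (HD : k < Cmod w * (m * m)) 
    by (assert (0 < m * m) by nra; unfold k; nra).
  apply Rle_trans with (Cmod (w - z) * (Cmod (w - z) / k)).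
  - unfold Rdiv. rewrite Rmult_assoc. apply Rmult_le_compat_l; [apply Cmod_ge_0|].
    apply Rmult_le_compat_l; [apply Cmod_ge_0|]. apply Rinv_le_contravar; lra.
  - rewrite Rmult_comm. apply Rmult_le_compat_r; [apply Cmod_ge_0|].
    apply Rmult_le_reg_r with k; [exact Hk|].
    replace (Cmod (w - z) / k * k) with (Cmod (w - z)) by (field; lra). lra.
Qed.

(** Meant for the difference quotient, which is given by a formula only off [0]; a radius at most
    [|z|] keeps [0] out of the neighbourhood. *)
Lemma is_derive_C_ext_punctured (f g : C -> C) (z l : C) :
  (forall w : C, w <> 0 -> f w = g w) -> z <> 0 -> is_derive f z l -> is_derive g z l.
Proof.
  intros Hfg Hz H. apply is_derive_C_eps. intros eps Heps.
  apply is_derive_C_eps with (eps := eps) in H; [|exact Heps].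
  destruct H as (delta & Hd & H).
  exists (Rmin delta (Cmod z)). split.
  - apply Rmin_pos; [exact Hd|now apply Cmod_gt_0].
  - intros w Hw. assert (w <> 0).
    { intro E. subst w. apply Rlt_not_le in Hw; apply Hw.
      replace (0 - z)%C with (- z)%C by ring. rewrite Cmod_opp. apply Rmin_r. }
    rewrite <- (Hfg w), <- (Hfg z) by assumption. apply H.
    eapply Rlt_le_trans; [exact Hw|apply Rmin_l].
Qed.

Lemma is_derive_C_shift (f : C -> C) (a z l : C) :
  is_derive f (a + z)%C l -> is_derive (fun w => f (a + w)%C) z l.
Proof.
  intros H. apply is_derive_C_eps. intros eps Heps.
  apply is_derive_C_eps with (eps := eps) in H; [|exact Heps].
  destruct H as (delta & Hd & H). exists delta. split; [exact Hd|].
  intros w Hw. replace (w - z)%C with (a + w - (a + z))%C by ring. apply H.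
  replace (a + w - (a + z))%C with (w - z)%C by ring. exact Hw.
Qed.

(** * The complex exponential *)

Definition Cexp (z : C) : C := (exp (Re z) * cos (Im z), exp (Re z) * sin (Im z)).

Lemma Cexp_plus (z w : C) : Cexp (z + w) = (Cexp z * Cexp w)%C.
Proof.
  destruct z as [a b], w as [c d]. unfold Cexp, Cmult, Cplus; simpl.
  rewrite exp_plus, cos_plus, sin_plus. f_equal; ring.
Qed.

Lemma Cmod_Cexp (z : C) : Cmod (Cexp z) = exp (Re z).
Proof.
  unfold Cmod, Cexp; cbn [fst snd].
  rewrite !Rpow_mult_distr, <- Rmult_plus_distr_l.
  replace (cos (Im z) ^ 2 + sin (Im z) ^ 2) with 1.
  - rewrite Rmult_1_r. apply sqrt_pow2. left; apply exp_pos.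
  - rewrite <- (sin2_cos2 (Im z)). unfold Rsqr. ring.
Qed.

Lemma derivable_pt_lim_0_eps (f : R -> R) (l : R) : derivable_pt_lim f 0 l ->
  forall eps, 0 < eps -> exists delta, 0 < delta /\ forall h, Rabs h < delta ->
    Rabs (f h - f 0 - l * h) <= eps * Rabs h.
Proof.
  intros H eps Heps. destruct (H eps Heps) as [delta Hd].
  exists delta. split; [apply cond_pos|]. intros h Hh.
  destruct (Req_dec h 0) as [->|h0].
  - rewrite Rabs_R0. replace (f 0 - f 0 - l * 0) with 0 by ring. rewrite Rabs_R0. lra.
  - specialize (Hd h h0 Hh). rewrite Rplus_0_l in Hd.
    replace (f h - f 0 - l * h) with (((f h - f 0) / h - l) * h) by (field; exact h0).
    rewrite Rabs_mult. apply Rmult_le_compat_r; [apply Rabs_pos|lra].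
Qed.

(** The remainder has real part [e^x (cos y - 1) + (e^x - 1 - x)] and imaginary part
    [e^x (sin y - y) + (e^x - 1) y], so the real expansions of [exp], [cos] and [sin] at [0]
    suffice. *)
Lemma is_derive_Cexp_0 : is_derive Cexp (0 : C) (1 : C).
Proof.
  apply is_derive_C_eps. intros eps Heps.
  (* The four terms are at most [2 e m], [e m], [2 e m] and [2 e m], in all [7 e m]; the bound
     [1 / 2] keeps [exp x] below [2]. *)
  set (e := Rmin (eps / 10) (1 / 2)).
  assert (He : 0 < e) by (apply Rmin_pos; lra).
  assert (He1 : e <= eps / 10) by apply Rmin_l.
  assert (He2 : e <= 1 / 2) by apply Rmin_r.
  assert (De : derivable_pt_lim exp 0 1) by apply derivable_pt_lim_exp_0.
  assert (Dc : derivable_pt_lim cos 0 0).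
  { replace 0 with (- sin 0) at 2 by (rewrite sin_0; ring). apply derivable_pt_lim_cos. }
  assert (Ds : derivable_pt_lim sin 0 1).
  { rewrite <- cos_0. apply derivable_pt_lim_sin. }
  destruct (derivable_pt_lim_0_eps _ _ De e He) as (d1 & Hd1 & E1).
  destruct (derivable_pt_lim_0_eps _ _ Dc e He) as (d2 & Hd2 & E2).
  destruct (derivable_pt_lim_0_eps _ _ Ds e He) as (d3 & Hd3 & E3).
  exists (Rmin (Rmin d1 d2) (Rmin d3 e)).
  split; [apply Rmin_pos; apply Rmin_pos; assumption|].
  intros w Hw.
  replace (w - 0)%C with w in * by ring.
  assert (L : Cmod w < d1 /\ Cmod w < d2 /\ Cmod w < d3 /\ Cmod w < e).
  { repeat split; (eapply Rlt_le_trans; [exact Hw|]).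
    - eapply Rle_trans; apply Rmin_l.
    - eapply Rle_trans; [apply Rmin_l|apply Rmin_r].
    - eapply Rle_trans; [apply Rmin_r|apply Rmin_l].
    - eapply Rle_trans; apply Rmin_r. }
  destruct w as [x y]. set (m := Cmod (x, y)) in *.
  assert (Hx : Rabs x <= m) by apply (re_le_Cmod (x, y)).
  assert (Hy : Rabs y <= m) by apply (im_le_Cmod (x, y)).
  assert (Hm : 0 <= m) by apply Cmod_ge_0.
  specialize (E1 x). specialize (E2 y). specialize (E3 y).
  rewrite exp_0 in E1. rewrite cos_0 in E2. rewrite sin_0 in E3.
  assert (F1 : Rabs (exp x - 1 - 1 * x) <= e * m).
  { eapply Rle_trans; [apply E1; lra|]. apply Rmult_le_compat_l; lra. }
  assert (F2 : Rabs (cos y - 1 - 0 * y) <= e * m).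
  { eapply Rle_trans; [apply E2; lra|]. apply Rmult_le_compat_l; lra. }
  assert (F3 : Rabs (sin y - 0 - 1 * y) <= e * m).
  { eapply Rle_trans; [apply E3; lra|]. apply Rmult_le_compat_l; lra. }
  assert (F0 : Rabs (exp x - 1) <= 2 * e).
  { replace (exp x - 1) with ((exp x - 1 - 1 * x) + x) by ring.
    eapply Rle_trans; [apply Rabs_triang|]. nra. }
  assert (F4 : Rabs (exp x) <= 2).
  { replace (exp x) with ((exp x - 1) + 1) by ring.
    eapply Rle_trans; [apply Rabs_triang|]. rewrite Rabs_R1. lra. }
  replace (Cexp (x, y) - Cexp 0 - 1 * (x, y))%C with
    ((exp x * (cos y - 1 - 0 * y) + (exp x - 1 - 1 * x),
      exp x * (sin y - 0 - 1 * y) + (exp x - 1) * y) : C).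
  2: { unfold Cexp, Cminus, Cplus, Copp, Cmult, RtoC; simpl.
       rewrite exp_0, cos_0, sin_0. f_equal; ring. }
  eapply Rle_trans; [apply Cmod_le_sum|].
  assert (A1 := Rabs_triang (exp x * (cos y - 1 - 0 * y)) (exp x - 1 - 1 * x)).
  assert (A2 := Rabs_triang (exp x * (sin y - 0 - 1 * y)) ((exp x - 1) * y)).
  rewrite Rabs_mult in A1, A2. rewrite (Rabs_mult (exp x - 1)) in A2.
  assert (B1 : Rabs (exp x) * Rabs (cos y - 1 - 0 * y) <= 2 * (e * m)).
  { apply Rmult_le_compat; auto using Rabs_pos. }
  assert (B2 : Rabs (exp x) * Rabs (sin y - 0 - 1 * y) <= 2 * (e * m)).
  { apply Rmult_le_compat; auto using Rabs_pos. }
  assert (B3 : Rabs (exp x - 1) * Rabs y <= 2 * e * m).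
  { apply Rmult_le_compat; auto using Rabs_pos. }
  assert (e * m <= eps / 10 * m) by (apply Rmult_le_compat_r; lra).
  assert (0 <= eps * m) by (apply Rmult_le_pos; lra).
  lra.
Qed.

(** The functional equation carries the expansion at [0] over to [z], multiplying the error by the
    modulus of [Cexp z]. *)
Lemma is_derive_Cexp (z : C) : is_derive Cexp z (Cexp z).
Proof.
  apply is_derive_C_eps. intros eps Heps.
  set (m := Cmod (Cexp z)).
  assert (Hm : 0 < m) by (unfold m; rewrite Cmod_Cexp; apply exp_pos).
  destruct (proj1 (is_derive_C_eps _ _ _) is_derive_Cexp_0 (eps / m)) as (delta & Hd & H).
  { now apply Rdiv_lt_0_compat. }
  exists delta. split; [exact Hd|]. intros w Hw.
  specialize (H (w - z)%C). replace (w - z - 0)%C with (w - z)%C in H by ring.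
  specialize (H Hw).
  replace (Cexp w - Cexp z - Cexp z * (w - z))%C
    with (Cexp z * (Cexp (w - z) - Cexp 0 - 1 * (w - z)))%C.
  - rewrite Cmod_mult. fold m.
    apply Rle_trans with (m * (eps / m * Cmod (w - z))).
    + apply Rmult_le_compat_l; [lra|exact H].
    + right. field. lra.
  - replace (Cexp w) with (Cexp z * Cexp (w - z))%C.
    + replace (Cexp 0) with (RtoC 1).
      * ring.
      * unfold Cexp, RtoC; simpl. rewrite exp_0, cos_0, sin_0. f_equal; ring.
    + rewrite <- Cexp_plus. f_equal. ring.
Qed.

Lemma is_derive_C_CR_at (f : C -> C) (x y : R) (l : C) : is_derive f ((x, y) : C) l ->
  CR_at (fun a b => Re (f (a, b))) (fun a b => Im (f (a, b))) x y.
Proof.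
  intros H. exists (Re l), (Im l). intros eps Heps.
  apply is_derive_C_eps with (eps := eps) in H; [|exact Heps].
  destruct H as (delta & Hd & H).
  exists (delta / 2). split; [lra|]. intros a b Ha Hb.
  assert (E : Cmod ((a, b) - (x, y)) <= Rabs (a - x) + Rabs (b - y)).
  { apply (Cmod_le_sum (a - x) (b - y)). }
  specialize (H (a, b) ltac:(lra)).
  assert (E' : Cmod (f (a, b) - f (x, y) - l * ((a, b) - (x, y)))
               <= eps * (Rabs (a - x) + Rabs (b - y))).
  { eapply Rle_trans; [exact H|]. apply Rmult_le_compat_l; lra. }
  split; eapply Rle_trans; try exact E'.
  - eapply Rle_trans; [|apply re_le_Cmod].
    destruct l as [p q], (f (a, b)), (f (x, y)); simpl. apply Req_le, f_equal. ring.
  - eapply Rle_trans; [|apply im_le_Cmod].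
    destruct l as [p q], (f (a, b)), (f (x, y)); simpl. apply Req_le, f_equal. ring.
Qed.

(** * Positivity at the center of a disk, by circular means *)

Lemma Re_center_nonneg (Q : C -> C) (r : R) :
  0 < r ->
  (forall eps, 0 < eps -> exists delta, 0 < delta /\ forall z : C, Cmod z < delta ->
     Cmod (Q z - Q 0) < eps) ->
  (forall z : C, z <> 0 -> Cmod z <= r -> ex_derive Q z) ->
  (forall z : C, Cmod z = r -> 0 <= Re (Q z)) ->
  0 <= Re (Q 0).
Proof.
  intros Hr Hcont Hder Hpos.
  destruct (Rle_dec 0 (Re (Q 0))) as [h|h]; [exact h|exfalso].
  apply Rnot_le_lt in h.
  (* Since [Re (Q 0) = - 2 k], continuity puts [Re Q] below [- k] on the small circle of radius
     [r0]. *)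
  set (k := - Re (Q 0) / 2). assert (Hk : 0 < k) by (unfold k; lra).
  destruct (Hcont k Hk) as (delta & Hd & HQ).
  set (r0 := Rmin (delta / 2) r).
  assert (Hr0 : 0 < r0) by (apply Rmin_pos; lra).
  assert (Hr0d : r0 < delta) by (eapply Rle_lt_trans; [apply Rmin_l|lra]).
  assert (Hr0r : r0 <= r) by apply Rmin_r.
  (* In the coordinate [log z] the annulus [r0 <= |z| <= r], which avoids [0], becomes a rectangle
     of height [2 PI]. *)
  set (u := fun x y => Re (Q (Cexp (x, y)))).
  set (v := fun x y => Im (Q (Cexp (x, y)))).
  assert (Hle : ln r0 <= ln r).
  { destruct Hr0r as [Hlt| ->]; [left; now apply ln_increasing|right; reflexivity]. }
  assert (Hpi := PI_RGT_0).
  assert (Hon : CR_on u v (ln r0) (ln r) 0 (2 * PI)).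
  { intros x y [_ Hx] _.
    destruct (Hder (Cexp (x, y))) as [l Hl].
    - intro E. apply (f_equal Cmod) in E. rewrite Cmod_Cexp, Cmod_0 in E.
      change (exp x = 0) in E. generalize (exp_pos x); lra.
    - rewrite Cmod_Cexp. simpl. rewrite <- (exp_ln r Hr).
      destruct Hx as [Hx| ->]; [left; now apply exp_increasing|right; reflexivity].
    - apply (is_derive_C_CR_at (fun z => Q (Cexp z)) x y (Cexp (x, y) * l)%C).
      apply is_derive_C_comp; [exact Hl|apply is_derive_Cexp]. }
  assert (H2pi : 0 <= 2 * PI) by lra.
  assert (G := goursat_rectangle u v _ _ _ _ Hle H2pi Hon).
  destruct (CR_on_ex_RInt u v _ _ _ _ Hle H2pi Hon) as [U _].
  unfold circulation in G.
  (* The horizontal sides cancel by periodicity of the exponential. *)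
  replace (RInt (fun x => v x 0 - v x (2 * PI)) (ln r0) (ln r)) with 0 in G.
  2: { symmetry. rewrite (RInt_ext _ (fun _ => 0)).
       - rewrite RInt_const. unfold scal; simpl; unfold mult; simpl. ring.
       - intros x _. unfold v, Cexp; simpl Re; simpl Im.
         rewrite cos_2PI, sin_2PI, cos_0, sin_0. apply Rminus_diag. }
  (* The vertical sides would contribute at least [2 PI k > 0], whereas Goursat's theorem gives
     [0]. *)
  assert (L : RInt (fun _ => k) 0 (2 * PI)
              <= RInt (fun y => u (ln r) y - u (ln r0) y) 0 (2 * PI)).
  { apply RInt_le; [lra|apply @ex_RInt_const| |].
    - apply @ex_RInt_minus; apply U; lra.
    - intros y _.
      assert (P : 0 <= u (ln r) y).
      { apply Hpos. rewrite Cmod_Cexp. simpl. now apply exp_ln. }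
      assert (N : Rabs (Re (Q (Cexp (ln r0, y)) - Q 0)) < k).
      { eapply Rle_lt_trans; [apply re_le_Cmod|]. apply HQ.
        rewrite Cmod_Cexp. simpl. rewrite exp_ln; assumption. }
      apply Rabs_lt_between in N. unfold u in *.
      replace (Re (Q (Cexp (ln r0, y)) - Q 0))
        with (Re (Q (Cexp (ln r0, y))) - Re (Q 0)) in N by reflexivity.
      unfold k in *. lra. }
  rewrite RInt_const in L. unfold scal in L; simpl in L; unfold mult in L; simpl in L.
  nra.
Qed.

(** * Derivative bound for functions with nonnegative real part *)

(** Used with [l] the derivative of [g] at [0], the value that makes the quotient continuous
    there. *)
Definition difference_quotient (g : C -> C) (l z : C) : C :=
  if Ceq_dec z 0 then l else ((g z - g 0) / z)%C.

Lemma difference_quotient_continuous (g : C -> C) (l : C) (eps : R) :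
  is_derive g (0 : C) l -> 0 < eps -> exists delta, 0 < delta /\ forall z : C,
  Cmod z < delta ->
  Cmod (difference_quotient g l z - difference_quotient g l 0) <= eps.
Proof.
  intros Hl Heps.
  destruct (proj1 (is_derive_C_eps _ _ _) Hl eps Heps) as (delta & Hd & H).
  exists delta. split; [exact Hd|]. intros z Hz. unfold difference_quotient.
  destruct (Ceq_dec 0 0) as [_|n]; [|now elim n].
  destruct (Ceq_dec z 0) as [E|nz].
  - replace (l - l)%C with (RtoC 0) by ring. rewrite Cmod_0. lra.
  - specialize (H z). replace (z - 0)%C with z in H by ring. specialize (H Hz).
    replace ((g z - g 0) / z - l)%C with ((g z - g 0 - l * z) / z)%C
      by (field; exact nz).
    rewrite Cmod_div by exact nz.
    assert (0 < Cmod z) by now apply Cmod_gt_0.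
    apply Rmult_le_reg_r with (Cmod z); [assumption|].
    unfold Rdiv. rewrite Rmult_assoc, Rinv_l, Rmult_1_r by lra. exact H.
Qed.

(* On [|z| = r] the real part of
   [2 g + W z g + conj W r^2 q + W conj (g 0) z], with [r |W| = 1] and [q] the
   difference quotient, is
   [2 Re g (1 + Re (W z)) >= 0]. *)
Lemma norm_derive_center_le (g : C -> C) (r : R) (l : C) :
  0 < r ->
  (forall z : C, Cmod z <= r -> ex_derive g z) ->
  (forall z : C, Cmod z <= r -> 0 <= Re (g z)) ->
  is_derive g (0 : C) l -> r * Cmod l <= 2 * Re (g 0).
Proof.
  intros Hr Hder Hpos Hl.
  set (q := difference_quotient g l).
  assert (H0 : 0 <= Re (g 0)) by (apply Hpos; rewrite Cmod_0; lra).
  destruct (Ceq_dec l 0) as [E|nl].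
  { rewrite E, Cmod_0. lra. }
  assert (Hml : 0 < Cmod l) by now apply Cmod_gt_0.
  (* The phase of [W] is chosen so that [Cconj W * r ^ 2 * l = - r |l|]; hence
     [Q 0 = 2 g(0) - r |l|], and [Re (Q 0) >= 0] is the claim. *)
  set (W := (- (l / RtoC (r * Cmod l)))%C).
  assert (HW : Cmod W = / r).
  { unfold W. rewrite Cmod_opp, Cmod_div, Cmod_R.
    - rewrite Rabs_pos_eq by nra. field. lra.
    - intro E. apply RtoC_inj in E. nra. }
  set (P := fun z : C => ((2 + W * z) * g z + (W * Cconj (g 0)) * z)%C).
  set (Q := fun z : C => (P z + (Cconj W * RtoC (r ^ 2)) * q z)%C).
  assert (DP : forall z : C, Cmod z <= r -> ex_derive P z).
  { intros z Hz. destruct (Hder z Hz) as [dg Hdg].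
    eexists. unfold P. apply is_derive_C_plus.
    - apply is_derive_C_mult; [|exact Hdg].
      apply is_derive_C_plus; [apply is_derive_C_const|].
      apply is_derive_C_mult; [apply is_derive_C_const|apply is_derive_C_id].
    - apply is_derive_C_mult; [apply is_derive_C_const|apply is_derive_C_id]. }
  assert (K : 0 <= Re (Q 0)).
  { apply (Re_center_nonneg Q r Hr).
    - intros eps Heps.
      destruct (DP 0) as [dP HdP]; [rewrite Cmod_0; lra|].
      destruct (is_derive_C_continuous _ _ _ HdP (eps / 2)) as (d1 & Hd1 & H1); [lra|].
      destruct (difference_quotient_continuous g l (eps / 2 / r) Hl) as (d2 & Hd2 & H2).
      { apply Rdiv_lt_0_compat; lra. }
      exists (Rmin d1 d2). split; [now apply Rmin_pos|]. intros z Hz.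
      replace (Q z - Q 0)%C
        with ((P z - P 0) + (Cconj W * RtoC (r ^ 2)) * (q z - q 0))%C
        by (unfold Q; ring).
      eapply Rle_lt_trans; [apply Cmod_triangle|].
      rewrite !Cmod_mult, Cmod_conj, HW, Cmod_R, Rabs_pos_eq by nra.
      specialize (H1 z). replace (z - 0)%C with z in H1 by ring.
      specialize (H1 (Rlt_le_trans _ _ _ Hz (Rmin_l _ _))).
      specialize (H2 z (Rlt_le_trans _ _ _ Hz (Rmin_r _ _))).
      assert (/ r * r ^ 2 * Cmod (q z - q 0) <= eps / 2); [|lra].
      replace (/ r * r ^ 2) with r by (field; lra).
      apply Rle_trans with (r * (eps / 2 / r)).
      + apply Rmult_le_compat_l; [lra|exact H2].
      + right; field; lra.
    - intros z nz Hz.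
      destruct (DP z Hz) as [dP HdP]. destruct (Hder z Hz) as [dg Hdg].
      eexists. unfold Q. apply is_derive_C_plus; [exact HdP|].
      apply is_derive_C_mult; [apply is_derive_C_const|].
      apply is_derive_C_ext_punctured with (f := fun w => ((g w + - g 0) * / w)%C);
        [|exact nz|].
      + intros w nw. unfold q, difference_quotient.
        destruct (Ceq_dec w 0); [contradiction|reflexivity].
      + apply is_derive_C_mult; [|now apply is_derive_C_inv].
        apply is_derive_C_plus; [exact Hdg|apply is_derive_C_const].
    - intros z Hz.
      assert (nz : z <> 0) by (intro E; rewrite E, Cmod_0 in Hz; lra).
      assert (Ez : RtoC (r ^ 2) = (z * Cconj z)%C).
      { rewrite <- Cmod2_conj, Hz. reflexivity. }
      (* On the circle [r ^ 2 = z * Cconj z] cancels the denominator of [q]. The second summand is a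
         conjugate minus the number itself, hence purely imaginary. *)
      assert (EQ : Q z = ((2 + W * z + Cconj (W * z)) * g z
               + (Cconj (Cconj (W * z) * g 0) - Cconj (W * z) * g 0))%C).
      { unfold Q, P, q, difference_quotient. destruct (Ceq_dec z 0); [contradiction|].
        rewrite Ez, !Cmult_conj, !Cconj_conj. field. exact nz. }
      assert (H1 : Rabs (Re (W * z)) <= 1).
      { eapply Rle_trans; [apply re_le_Cmod|]. rewrite Cmod_mult, HW, Hz.
        right; field; lra. }
      apply Rabs_le_between in H1.
      assert (H2 : 0 <= Re (g z)) by (apply Hpos; lra).
      replace (Re (Q z)) with (2 * Re (g z) * (1 + Re (W * z))); [nra|].
      rewrite EQ. destruct (W * z)%C, (g z), (g 0). simpl. ring. }
  replace (Q 0) with (2 * g 0 + - RtoC (r * Cmod l))%C in K.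
  - destruct (g 0) as [a b]. simpl in *. lra.
  - unfold Q, P, q, difference_quotient, W. destruct (Ceq_dec 0 0) as [_|n]; [|now elim n].
    rewrite Copp_conj, Cdiv_conj.
    2: { intro E. apply RtoC_inj in E. nra. }
    assert (El : (l * Cconj l)%C = (RtoC (Cmod l) * RtoC (Cmod l))%C).
    { rewrite <- Cmod2_conj. rewrite <- RtoC_mult. f_equal. ring. }
    assert (Er : RtoC r <> 0) by (intro E; apply RtoC_inj in E; lra).
    assert (Em : RtoC (Cmod l) <> 0) by (intro E; apply RtoC_inj in E; lra).
    replace (Cconj (RtoC (r * Cmod l))) with (RtoC (r * Cmod l)).
    2: { unfold Cconj, RtoC; simpl. f_equal. ring. }
    replace (RtoC (r ^ 2)) with (RtoC r * RtoC r)%C.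
    2: { rewrite <- RtoC_mult. f_equal. ring. }
    rewrite !RtoC_mult.
    transitivity (2 * g 0 - r * (l * Cconj l) / Cmod l)%C.
    + rewrite El. field. exact Em.
    + field. split; assumption.
Qed.

Lemma norm_derive_le (g : C -> C) (z0 l : C) (r : R) :
  0 < r ->
  (forall z : C, Cmod (z - z0) <= r -> ex_derive g z) ->
  (forall z : C, Cmod (z - z0) <= r -> 0 <= Re (g z)) ->
  is_derive g z0 l -> r * Cmod l <= 2 * Re (g z0).
Proof.
  intros Hr Hder Hpos Hl.
  replace (g z0) with (g (z0 + 0)%C) by (f_equal; ring).
  apply (norm_derive_center_le (fun z => g (z0 + z)%C) r l Hr).
  - intros z Hz. destruct (Hder (z0 + z)%C) as [dg Hdg].
    + replace (z0 + z - z0)%C with z by ring. exact Hz.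
    + exists dg. now apply is_derive_C_shift.
  - intros z Hz. apply Hpos. replace (z0 + z - z0)%C with z by ring. exact Hz.
  - apply is_derive_C_shift. replace (z0 + 0)%C with z0 by ring. exact Hl.
Qed.

(** * Harnack's inequality along a segment *)

Lemma is_derive_Re_line (f : C -> C) (a b l : C) (t : R) :
  is_derive f (a + RtoC t * b)%C l ->
  is_derive (fun s : R => Re (f (a + RtoC s * b)%C)) t (Re (l * b)).
Proof.
  intros H. apply is_derive_Reals. intros eps Heps.
  (* The [+ 1] allows division by [m] even when [b = 0]. *)
  set (m := Cmod b + 1). assert (Hm : 0 < m) by (unfold m; generalize (Cmod_ge_0 b); lra).
  destruct (proj1 (is_derive_C_eps _ _ _) H (eps / 2 / m)) as (delta & Hd & HD).
  { apply Rdiv_lt_0_compat; lra. }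
  assert (Hdm : 0 < delta / m) by now apply Rdiv_lt_0_compat.
  exists (mkposreal _ Hdm). intros h h0 Hh. simpl in Hh.
  specialize (HD (a + RtoC (t + h) * b)%C).
  replace (a + RtoC (t + h) * b - (a + RtoC t * b))%C with (RtoC h * b)%C in HD
    by (rewrite RtoC_plus; ring).
  rewrite Cmod_mult, Cmod_R in HD.
  assert (Hh' : Rabs h * m < delta).
  { apply Rmult_lt_reg_r with (/ m); [now apply Rinv_0_lt_compat|].
    rewrite Rmult_assoc, Rinv_r, Rmult_1_r by lra. exact Hh. }
  assert (Hh0 : 0 < Rabs h) by now apply Rabs_pos_lt.
  assert (Hb : Cmod b <= m) by (unfold m; lra).
  specialize (HD ltac:(nra)).
  set (X := (f (a + RtoC (t + h) * b) - f (a + RtoC t * b) - l * (RtoC h * b))%C) in *.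
  replace ((Re (f (a + RtoC (t + h) * b)%C) - Re (f (a + RtoC t * b)%C)) / h - Re (l * b))
    with (Re X / h).
  2: { unfold X. destruct (f (a + RtoC (t + h) * b)%C), (f (a + RtoC t * b)%C), l, b.
       simpl. field. exact h0. }
  unfold Rdiv. rewrite Rabs_mult, Rabs_inv.
  apply Rmult_lt_reg_r with (Rabs h); [exact Hh0|].
  rewrite Rmult_assoc, Rinv_l, Rmult_1_r by lra.
  eapply Rle_lt_trans; [apply re_le_Cmod|].
  eapply Rle_lt_trans; [exact HD|].
  apply Rle_lt_trans with (eps / 2 / m * (Rabs h * m)).
  - apply Rmult_le_compat_l; [|apply Rmult_le_compat_l; lra].
    left. apply Rdiv_lt_0_compat; lra.
  - replace (eps / 2 / m * (Rabs h * m)) with (eps / 2 * Rabs h) by (field; lra). nra.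
Qed.

(** A Gronwall argument: along the segment the derivative bound gives [h' <= K h], so
    [exp (- K t) * h t] does not increase. *)
Lemma harnack_segment (g : C -> C) (a b : C) (r : R) :
  0 < r ->
  (forall t z, 0 <= t <= 1 -> Cmod (z - (a + RtoC t * b)) <= r ->
     ex_derive g z /\ 0 <= Re (g z)) ->
  Re (g (a + b)%C) <= exp (2 * Cmod b / r) * Re (g a).
Proof.
  intros Hr H.
  set (K := 2 * Cmod b / r).
  set (h := fun t : R => Re (g (a + RtoC t * b)%C)).
  assert (Hself : forall z : C, Cmod (z - z) <= r).
  { intro z. replace (z - z)%C with (RtoC 0) by ring. rewrite Cmod_0. lra. }
  assert (Hd : forall t, 0 <= t <= 1 -> exists dh, is_derive h t dh /\ dh <= K * h t).
  { intros t Ht.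
    destruct (H t (a + RtoC t * b)%C Ht (Hself _)) as [[l Hl] _].
    exists (Re (l * b)). split; [now apply is_derive_Re_line|].
    assert (B : r * Cmod l <= 2 * h t).
    { apply norm_derive_le; try assumption; intros z Hz; apply (H t z Ht Hz). }
    eapply Rle_trans; [apply Rle_abs|]. eapply Rle_trans; [apply re_le_Cmod|].
    rewrite Cmod_mult. unfold K.
    replace (2 * Cmod b / r * h t) with (Cmod b * ((2 * h t) / r)) by (field; lra).
    rewrite Rmult_comm. apply Rmult_le_compat_l; [apply Cmod_ge_0|].
    apply Rmult_le_reg_r with r; [exact Hr|].
    replace (2 * h t / r * r) with (2 * h t) by (field; lra). lra. }
  assert (D : forall t, 0 <= t <= 1 ->
    exists dh, is_derive (fun s => exp (- K * s) * h s) t dh /\ dh <= 0).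
  { intros t Ht. destruct (Hd t Ht) as (dh & D1 & D2).
    exists ((- K * exp (- K * t)) * h t + exp (- K * t) * dh). split.
    - apply (is_derive_mult (fun s => exp (- K * s)) h t).
      + auto_derive; [exact I|ring].
      + exact D1.
      + intros; apply Rmult_comm.
    - generalize (exp_pos (- K * t)). nra. }
  assert (M : exp (- K * 1) * h 1 <= exp (- K * 0) * h 0).
  { destruct (MVT_gen (fun s => exp (- K * s) * h s) 0 1
      (Derive (fun s => exp (- K * s) * h s))) as (c & Hc & E).
    - intros x Hx. rewrite Rmin_left, Rmax_right in Hx by lra.
      destruct (D x ltac:(lra)) as (dh & D1 & _).
      apply Derive_correct. now exists dh.
    - intros x Hx. rewrite Rmin_left, Rmax_right in Hx by lra.
      destruct (D x ltac:(lra)) as (dh & D1 & _).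
      apply continuity_pt_filterlim, (ex_derive_continuous (fun s : R => exp (- K * s) * h s)).
      now exists dh.
    - rewrite Rmin_left, Rmax_right in Hc by lra.
      destruct (D c Hc) as (dh & D1 & D2).
      rewrite (is_derive_unique (fun s : R => exp (- K * s) * h s) c dh D1) in E. lra. }
  unfold h in M. rewrite Rmult_0_r, exp_0, Rmult_1_l, Rmult_1_r in M.
  replace (a + RtoC 1 * b)%C with (a + b)%C in M by ring.
  replace (a + RtoC 0 * b)%C with a in M by ring.
  apply Rmult_le_compat_l with (r := exp K) in M; [|left; apply exp_pos].
  rewrite <- Rmult_assoc, <- exp_plus, Rplus_opp_r, exp_0, Rmult_1_l in M. exact M.
Qed.

(** * The map [ell], its rotations and the resulting inequality *)

Lemma RtoC_neq_0 (x : R) : x <> 0 -> RtoC x <> 0.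
Proof. intros h E. apply h. now apply RtoC_inj. Qed.

Lemma in_disk_neq_1 (a : C) : in_disk a -> (1 - a <> 0)%C.
Proof.
  intros H E. unfold in_disk in H.
  replace a with (RtoC 1) in H.
  - rewrite Cmod_1 in H. lra.
  - transitivity (a + (1 - a))%C; [ring|]. rewrite E. ring.
Qed.

(** Multiplying numerator and denominator by [Cconj (1 - a)] turns the numerator into
    [1 - |a|^2 + 2 i Im a]. *)
Lemma ell_components (a : C) : in_disk a ->
  ell a = ((1 - Cmod a ^ 2) / Cmod (1 - a) ^ 2, 2 * Im a / Cmod (1 - a) ^ 2).
Proof.
  intros H. assert (N := in_disk_neq_1 a H). apply Cmod_gt_0 in N.
  assert (N2 : 0 < Cmod (1 - a) ^ 2) by now apply pow_lt.
  rewrite !Cmod2_alt in *. destruct a as [x y].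
  unfold ell, Cdiv, Cmult, Cinv, Cplus, Cminus, Copp, RtoC in *; simpl in *.
  f_equal; field; intro E; nra.
Qed.

(** The conclusion is the real part of the product multiplied by the positive number
    [|1 - a|^2 |1 - b|^2]. *)
Lemma Re_ell_mult_pos (a b : C) : in_disk a -> in_disk b -> 0 < Re (ell a * ell b) ->
  0 < (1 - Cmod a ^ 2) * (1 - Cmod b ^ 2) - 4 * Im a * Im b.
Proof.
  intros Ha Hb H. rewrite !ell_components in H by assumption.
  assert (Na := in_disk_neq_1 a Ha). apply Cmod_gt_0 in Na. apply (pow_lt _ 2) in Na.
  assert (Nb := in_disk_neq_1 b Hb). apply Cmod_gt_0 in Nb. apply (pow_lt _ 2) in Nb.
  set (A := Cmod (1 - a) ^ 2) in *. set (B := Cmod (1 - b) ^ 2) in *.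
  replace ((1 - Cmod a ^ 2) * (1 - Cmod b ^ 2) - 4 * Im a * Im b)
    with (Re (((1 - Cmod a ^ 2) / A, 2 * Im a / A) *
              ((1 - Cmod b ^ 2) / B, 2 * Im b / B)) * (A * B)).
  - apply Rmult_lt_0_compat; [exact H|now apply Rmult_lt_0_compat].
  - unfold Cmult, Re; cbn [fst snd]. field. lra.
Qed.

Lemma class_P_ell_rotation (lam : C) : Cmod lam = 1 -> class_P (fun z => ell (lam * z)).
Proof.
  intros Hlam.
  assert (Hd : forall z, in_disk z -> in_disk (lam * z)).
  { intros z Hz. unfold in_disk. rewrite Cmod_mult, Hlam, Rmult_1_l. exact Hz. }
  repeat split.
  - intros z Hz. eexists. unfold ell, Cdiv, Cminus.
    assert (D1 : is_derive (fun w : C => lam * w)%C z (0 * z + lam * 1)%C).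
    { apply is_derive_C_mult; [apply is_derive_C_const|apply is_derive_C_id]. }
    apply is_derive_C_mult.
    + apply is_derive_C_plus; [apply is_derive_C_const|exact D1].
    + apply (is_derive_C_comp Cinv (fun w : C => 1 + - (lam * w))%C).
      * apply is_derive_C_inv. apply (in_disk_neq_1 (lam * z)), Hd, Hz.
      * apply is_derive_C_plus; [apply is_derive_C_const|].
        apply (is_derive_opp (K := C_AbsRing) (V := C_NormedModule)). exact D1.
  - intros z Hz. rewrite ell_components by now apply Hd.
    assert (N := in_disk_neq_1 _ (Hd z Hz)). apply Cmod_gt_0 in N. apply (pow_lt _ 2) in N.
    simpl Re. apply Rdiv_lt_0_compat; [|exact N].
    specialize (Hd z Hz). unfold in_disk in Hd. generalize (Cmod_ge_0 (lam * z)). nra.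
  - unfold ell. replace (lam * 0)%C with (RtoC 0) by ring. field.
Qed.

(* The rotations [lam] with [lam phi(z) = +- i |phi(z)|] give the extremal
   members [z |-> ell (lam z)] of the class. *)
Lemma Im_omega_le (phi omega : C -> C) (z : C) :
  schwarz_type phi -> schwarz_type omega ->
  (forall f : C -> C, class_P f -> class_P (T_op (fun z => ell (omega z)) phi f)) ->
  in_disk z ->
  4 * Cmod (phi z) * Rabs (Im (omega z))
    <= (1 - Cmod (phi z) ^ 2) * (1 - Cmod (omega z) ^ 2).
Proof.
  intros (_ & Hphi & _) (_ & Homega & _) HT Hz.
  specialize (Hphi z Hz). specialize (Homega z Hz).
  assert (Hp0 := Cmod_ge_0 (phi z)). assert (Ho0 := Cmod_ge_0 (omega z)).
  (* The rotation [lam] divides by [|phi z|], so zeros of [phi] are treated apart; there the left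
     side is [0]. *)
  destruct (Req_dec (Cmod (phi z)) 0) as [E|E].
  { unfold in_disk in *. rewrite E. nra. }
  set (rho := Cmod (phi z)) in *.
  assert (Key : forall s : R, Rabs s = 1 ->
    0 < (1 - Cmod (omega z) ^ 2) * (1 - rho ^ 2) - 4 * Im (omega z) * (s * rho)).
  { intros s Hs.
    set (lam := (RtoC s * Ci * Cconj (phi z) / RtoC rho)%C).
    assert (Hlam : Cmod lam = 1).
    { unfold lam. rewrite Cmod_div, !Cmod_mult, Cmod_Ci, Cmod_conj, !Cmod_R, Hs.
      - rewrite (Rabs_pos_eq rho) by assumption. fold rho. field. exact E.
      - now apply RtoC_neq_0. }
    assert (Hlp : (lam * phi z)%C = (0, s * rho)).
    { transitivity (RtoC s * Ci * (phi z * Cconj (phi z)) / RtoC rho)%C.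
      - unfold lam. field. now apply RtoC_neq_0.
      - rewrite <- Cmod2_conj. fold rho.
        replace (RtoC (rho ^ 2)) with (RtoC rho * RtoC rho)%C
          by (rewrite <- RtoC_mult; f_equal; ring).
        transitivity (RtoC s * Ci * RtoC rho)%C.
        + field. now apply RtoC_neq_0.
        + unfold RtoC, Ci, Cmult; simpl. f_equal; ring. }
    destruct (HT _ (class_P_ell_rotation lam Hlam)) as (_ & Hpos & _).
    specialize (Hpos z Hz). unfold T_op in Hpos.
    apply Re_ell_mult_pos in Hpos.
    - rewrite Cmod_mult, Hlam, Rmult_1_l in Hpos. fold rho in Hpos.
      rewrite Hlp in Hpos. exact Hpos.
    - exact Homega.
    - unfold in_disk. rewrite Cmod_mult, Hlam, Rmult_1_l. exact Hphi. }
  assert (K1 := Key 1 Rabs_R1).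
  assert (K2 := Key (-1) ltac:(rewrite Rabs_left; lra)).
  unfold Rabs. destruct (Rcase_abs (Im (omega z))); lra.
Qed.

(** * Points on rays ending at the boundary point *)

(** For [t > 0] these points run along the ray from [zeta] at angle [arctan k] to the inward radius;
    [k = 0] is the radius itself. *)
Definition stolz_point (zeta : C) (t k : R) : C := (zeta * (1 - RtoC t * (1, k)))%C.

Lemma Cmod_slope_le (k : R) : 0 <= k <= 1 -> Cmod (1, k) <= 2.
Proof.
  intros Hk. eapply Rle_trans; [apply Cmod_le_sum|].
  rewrite Rabs_R1, Rabs_pos_eq; lra.
Qed.

Lemma Cmod_stolz_point (zeta : C) (t k : R) : Cmod zeta = 1 -> 0 < t <= 1 / 2 ->
  0 <= k <= 1 -> Cmod (stolz_point zeta t k) <= 1 - t / 2.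
Proof.
  intros Hz Ht Hk. unfold stolz_point. rewrite Cmod_mult, Hz, Rmult_1_l.
  apply Rsqr_incr_0_var; [|lra]. rewrite !Rsqr_pow2, Cmod2_alt.
  replace (Re (1 - RtoC t * (1, k))) with (1 - t) by (simpl; ring).
  replace (Im (1 - RtoC t * (1, k))) with (- (k * t)) by (simpl; ring).
  (* For [t > 0], [(1 - t)^2 + t^2 <= (1 - t / 2)^2] amounts to [7 t <= 4], which [t <= 1 / 2]
     ensures. *)
  assert (0 <= k * t <= t) by nra. nra.
Qed.

Lemma stolz_point_dist (zeta : C) (t k : R) : Cmod zeta = 1 -> 0 < t -> 0 <= k <= 1 ->
  Cmod (stolz_point zeta t k - zeta) <= 2 * t.
Proof.
  intros Hz Ht Hk. unfold stolz_point.
  replace (zeta * (1 - RtoC t * (1, k)) - zeta)%C with (- (zeta * (RtoC t * (1, k))))%C by ring.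
  rewrite Cmod_opp, !Cmod_mult, Hz, Cmod_R, Rabs_pos_eq by lra.
  generalize (Cmod_slope_le k Hk). nra.
Qed.

Lemma nontangential_limit_stolz_point (f : C -> C) (zeta L : C) (k : R) :
  Cmod zeta = 1 -> 0 <= k <= 1 -> nontangential_limit f zeta L ->
  forall eps, 0 < eps -> exists delta, 0 < delta <= 1 / 2 /\ forall t, 0 < t < delta ->
    Cmod (f (stolz_point zeta t k) - L) < eps.
Proof.
  intros Hz Hk H eps Heps.
  (* The aperture [4] is the ratio of the bounds [|z - zeta| <= 2 t] and [1 - |z| >= t / 2]. *)
  destruct (H 4 ltac:(lra) eps Heps) as (delta & Hd & HL).
  exists (Rmin (delta / 2) (1 / 2)). split.
  - split; [apply Rmin_pos; lra|apply Rmin_r].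
  - intros t [Ht0 Ht].
    assert (h1 := Rlt_le_trans _ _ _ Ht (Rmin_l _ _)).
    assert (h2 := Rlt_le_trans _ _ _ Ht (Rmin_r _ _)).
    assert (M := Cmod_stolz_point zeta t k Hz ltac:(lra) Hk).
    assert (D := stolz_point_dist zeta t k Hz Ht0 Hk).
    apply HL.
    + unfold in_disk. lra.
    + lra.
    + replace (zeta - stolz_point zeta t k)%C with (- (stolz_point zeta t k - zeta))%C by ring.
      rewrite Cmod_opp. lra.
Qed.

(** * Boundary behaviour of [omega] and [phi] along these rays *)

Lemma Re_mean_value_le (f : C -> C) (a b : C) (e : R) :
  (forall t, 0 <= t <= 1 -> exists l : C, is_derive f (a + RtoC t * b)%C l /\ Cmod l <= e) ->
  Rabs (Re (f (a + b)%C) - Re (f a)) <= e * Cmod b.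
Proof.
  intros H.
  set (h := fun t : R => Re (f (a + RtoC t * b)%C)).
  assert (D : forall t, 0 <= t <= 1 -> exists l : C, is_derive h t (Re (l * b)) /\ Cmod l <= e).
  { intros t Ht. destruct (H t Ht) as (l & Hl & Hle).
    exists l. split; [now apply is_derive_Re_line|exact Hle]. }
  destruct (MVT_gen h 0 1 (Derive h)) as (c & Hc & E).
  - intros x Hx. rewrite Rmin_left, Rmax_right in Hx by lra.
    destruct (D x ltac:(lra)) as (l & D1 & _).
    apply Derive_correct. now exists (Re (l * b)).
  - intros x Hx. rewrite Rmin_left, Rmax_right in Hx by lra.
    destruct (D x ltac:(lra)) as (l & D1 & _).
    apply continuity_pt_filterlim, (ex_derive_continuous h). now exists (Re (l * b)).
  - rewrite Rmin_left, Rmax_right in Hc by lra.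
    destruct (D c Hc) as (l & D1 & D2).
    rewrite (is_derive_unique h c (Re (l * b)) D1) in E.
    unfold h in E. replace (a + RtoC 1 * b)%C with (a + b)%C in E by ring.
    replace (a + RtoC 0 * b)%C with a in E by ring.
    rewrite E, Rminus_0_r, Rmult_1_r.
    eapply Rle_trans; [apply re_le_Cmod|]. rewrite Cmod_mult.
    apply Rmult_le_compat_r; [apply Cmod_ge_0|exact D2].
Qed.

(** The real mean value theorem is applied to [f] and to [- Ci * f], whose real part is [Im f];
    adding the two bounds costs the factor [2]. *)
Lemma Cmod_mean_value_le (f : C -> C) (a b : C) (e : R) :
  (forall t, 0 <= t <= 1 -> exists l : C, is_derive f (a + RtoC t * b)%C l /\ Cmod l <= e) ->
  Cmod (f (a + b)%C - f a) <= 2 * e * Cmod b.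
Proof.
  intros H.
  assert (H1 := Re_mean_value_le f a b e H).
  assert (H2 : Rabs (Re (- Ci * f (a + b)%C) - Re (- Ci * f a)) <= e * Cmod b).
  { apply (Re_mean_value_le (fun z => - Ci * f z)%C). intros t Ht.
    destruct (H t Ht) as (l & Hl & Hle).
    exists (0 * f (a + RtoC t * b) + - Ci * l)%C. split.
    - apply (is_derive_C_mult (fun _ => - Ci)%C f); [apply is_derive_C_const|exact Hl].
    - replace (0 * f (a + RtoC t * b) + - Ci * l)%C with (- Ci * l)%C by ring.
      rewrite Cmod_mult, Cmod_opp, Cmod_Ci, Rmult_1_l. exact Hle. }
  destruct (f (a + b)%C) as [p q], (f a) as [p' q'].
  eapply Rle_trans; [apply (Cmod_le_sum (p - p') (q - q'))|].
  simpl in H1, H2.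
  replace (- (0) * p - - (1) * q - (- (0) * p' - - (1) * q')) with (q - q') in H2 by ring.
  lra.
Qed.

(** The function [omega z - d z] has derivative [domega z - d], small along the ray. The mean value
    bound runs from a point with parameter [s], far closer to [zeta] than [t], where the limit [eta]
    takes over. *)
Lemma angular_expansion (omega domega : C -> C) (zeta eta d : C) (k : R) :
  Cmod zeta = 1 -> 0 <= k <= 1 ->
  (forall z, in_disk z -> is_derive omega z (domega z)) ->
  nontangential_limit omega zeta eta -> nontangential_limit domega zeta d ->
  forall eps, 0 < eps -> exists delta, 0 < delta <= 1 / 2 /\ forall t, 0 < t < delta ->
    Cmod (omega (stolz_point zeta t k) - eta + d * zeta * (RtoC t * (1, k))) <= eps * t.
Proof.
  intros Hz Hk Hder Hlim Hdlim eps Heps.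
  (* The mean value bound over a length at most [2 t] costs [4 e t], the error at the inner point
     [e t]. *)
  set (e := eps / 5).
  destruct (nontangential_limit_stolz_point domega zeta d k Hz Hk Hdlim e)
    as (delta & Hd & HD); [unfold e; lra|].
  exists delta. split; [exact Hd|]. intros t Ht.
  assert (Het : 0 < e * t / 2) by (unfold e; nra).
  destruct (nontangential_limit_stolz_point omega zeta eta k Hz Hk Hlim (e * t / 2) Het)
    as (d' & Hd' & HL).
  assert (Hmd := Cmod_ge_0 d).
  (* The limit of [omega] comes without a rate, so [s] depends on [t]: [s < d'] makes
     [omega a - eta] small, and [s < q] does the same for [d * (a - zeta)]. *)
  set (q := e * t / 2 / (2 * (Cmod d + 1))).
  assert (Hq : 0 < q) by (apply Rdiv_lt_0_compat; lra).
  set (s := Rmin t (Rmin d' q) / 2).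
  assert (Hs0 : 0 < s).
  { unfold s. assert (0 < Rmin t (Rmin d' q)); [|lra].
    apply Rmin_pos; [lra|apply Rmin_pos; lra]. }
  assert (Hst : s < t).
  { generalize (Rmin_l t (Rmin d' q)). unfold s in *. lra. }
  assert (Hsd : s < d').
  { generalize (Rmin_r t (Rmin d' q)) (Rmin_l d' q). unfold s in *. lra. }
  assert (Hsq : s < q).
  { generalize (Rmin_r t (Rmin d' q)) (Rmin_r d' q). unfold s in *. lra. }
  set (f := fun z : C => (omega z + - d * z)%C).
  set (a := stolz_point zeta s k). set (b := (- (zeta * (RtoC (t - s) * (1, k))))%C).
  assert (Hab : forall x : R, (a + RtoC x * b)%C = stolz_point zeta (s + x * (t - s)) k).
  { intro x. unfold a, b, stolz_point.
    rewrite RtoC_plus, RtoC_mult. ring. }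
  assert (M : Cmod (f (a + b)%C - f a) <= 2 * e * Cmod b).
  { apply Cmod_mean_value_le. intros x Hx. rewrite Hab.
    assert (Hx' : 0 < s + x * (t - s) < delta) by nra.
    set (z := stolz_point zeta (s + x * (t - s)) k).
    exists (domega z + (0 * z + - d * 1))%C. split.
    - apply is_derive_C_plus.
      + apply Hder. unfold in_disk.
        assert (Cmod z <= 1 - (s + x * (t - s)) / 2); [|lra].
        apply Cmod_stolz_point; lra.
      + apply (is_derive_C_mult (fun _ => - d)%C (fun w => w));
          [apply is_derive_C_const|apply is_derive_C_id].
    - replace (domega z + (0 * z + - d * 1))%C with (domega z - d)%C by ring.
      left. apply HD. exact Hx'. }
  replace (a + b)%C with (stolz_point zeta t k) in M.
  2: { transitivity (a + RtoC 1 * b)%C; [rewrite Hab; f_equal; ring|ring]. }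
  assert (Hb : Cmod b <= 2 * t).
  { unfold b. rewrite Cmod_opp, !Cmod_mult, Hz, Cmod_R, Rabs_pos_eq by lra.
    generalize (Cmod_slope_le k Hk). nra. }
  assert (N : Cmod (f a - (eta - d * zeta)) <= e * t).
  { replace (f a - (eta - d * zeta))%C with ((omega a - eta) + - d * (a - zeta))%C
      by (unfold f; ring).
    eapply Rle_trans; [apply Cmod_triangle|].
    rewrite Cmod_mult, Cmod_opp.
    assert (A1 : Cmod (omega a - eta) < e * t / 2) by (apply HL; lra).
    assert (A2 : Cmod (a - zeta) <= 2 * s) by (apply stolz_point_dist; lra).
    assert (A3 : 2 * (Cmod d + 1) * q = e * t / 2) by (unfold q; field; lra).
    nra. }
  replace (omega (stolz_point zeta t k) - eta + d * zeta * (RtoC t * (1, k)))%C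
    with ((f (stolz_point zeta t k) - f a) + (f a - (eta - d * zeta)))%C
    by (unfold f, stolz_point; ring).
  eapply Rle_trans; [apply Cmod_triangle|].
  assert (0 < e) by (unfold e; lra).
  replace eps with (5 * e) by (unfold e; field). nra.
Qed.

(* Schwarz-Pick in disguise: [Re (1 - conj L phi)] is small at [(1 - t) zeta], and
   by Harnack stays small at bounded hyperbolic distance. *)
Lemma Cmod_stolz_point_to_1 (phi : C -> C) (zeta L : C) (k : R) :
  schwarz_type phi -> Cmod zeta = 1 -> Cmod L = 1 -> 0 <= k <= 1 ->
  radial_limit phi zeta L ->
  forall eps, 0 < eps -> exists delta, 0 < delta /\ forall t, 0 < t < delta ->
    1 - eps <= Cmod (phi (stolz_point zeta t k)).
Proof.
  intros (Hder & Hdisk & _) Hz HL Hk Hrad eps Heps.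
  (* The Harnack factor [exp (2 |b| / r)] with [|b| <= t] and [r = t / 4] is at most [exp 8],
     uniformly in [t]. *)
  assert (Hexp := exp_pos 8).
  destruct (Hrad (eps / exp 8)) as (delta & Hd & H).
  { now apply Rdiv_lt_0_compat. }
  exists (Rmin delta (1 / 2)). split; [apply Rmin_pos; lra|].
  intros t [Ht0 Ht].
  assert (h1 := Rlt_le_trans _ _ _ Ht (Rmin_l _ _)).
  assert (h2 := Rlt_le_trans _ _ _ Ht (Rmin_r _ _)).
  set (g := fun z : C => (1 + - Cconj L * phi z)%C).
  assert (Hg : forall z, Re (g z) = 1 - Re (Cconj L * phi z)).
  { intro z. unfold g. destruct (phi z), L. simpl. ring. }
  (* The segment leaves the radius perpendicularly, with [t] fixed and the slope going from [0] to
     [k]. *)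
  set (a := stolz_point zeta t 0). set (b := (- (zeta * (RtoC t * (0, k))))%C).
  assert (Hab : forall x : R, (a + RtoC x * b)%C = stolz_point zeta t (x * k)).
  { intro x. unfold a, b, stolz_point. destruct zeta as [p q].
    unfold RtoC, Cmult, Cminus, Cplus, Copp; simpl. f_equal; ring. }
  assert (Hk2 : Cmod (0, k) <= 1).
  { eapply Rle_trans; [apply Cmod_le_sum|]. rewrite Rabs_R0, Rabs_pos_eq; lra. }
  assert (Hb : Cmod b <= t).
  { unfold b. rewrite Cmod_opp, !Cmod_mult, Hz, Cmod_R, Rabs_pos_eq by lra. nra. }
  (* Points of the segment have modulus at most [1 - t / 2], so disks of radius [t / 4] about them
     stay inside the unit disk. *)
  assert (Hk1 := harnack_segment g a b (t / 4) ltac:(lra)).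
  replace (a + b)%C with (stolz_point zeta t k) in Hk1.
  2: { transitivity (a + RtoC 1 * b)%C; [rewrite Hab; f_equal; ring|ring]. }
  assert (Hh : Re (g (stolz_point zeta t k)) <= exp (2 * Cmod b / (t / 4)) * Re (g a)).
  { apply Hk1. intros x z Hx. rewrite Hab. intros Hzd.
    assert (in_disk z).
    { unfold in_disk.
      replace z with ((z - stolz_point zeta t (x * k)) + stolz_point zeta t (x * k))%C by ring.
      eapply Rle_lt_trans; [apply Cmod_triangle|].
      assert (Cmod (stolz_point zeta t (x * k)) <= 1 - t / 2); [|lra].
      apply Cmod_stolz_point; try lra. nra. }
    split.
    - destruct (Hder z H0) as [dphi Hdphi].
      eexists. apply is_derive_C_plus; [apply is_derive_C_const|].
      apply (is_derive_C_mult (fun _ => - Cconj L)%C phi);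
        [apply is_derive_C_const|exact Hdphi].
    - rewrite Hg. assert (B := re_le_Cmod (Cconj L * phi z)).
      rewrite Cmod_mult, Cmod_conj, HL in B.
      apply Rabs_le_between in B. specialize (Hdisk z H0). unfold in_disk in Hdisk. lra. }
  assert (Ha : Re (g a) <= eps / exp 8).
  { replace (g a) with (- (Cconj L * (phi a - L)))%C.
    - eapply Rle_trans; [apply Rle_abs|]. eapply Rle_trans; [apply re_le_Cmod|].
      rewrite Cmod_opp, Cmod_mult, Cmod_conj, HL, Rmult_1_l. left.
      replace a with (RtoC (1 - t) * zeta)%C.
      + apply H; lra.
      + unfold a, stolz_point. change ((1, 0) : C) with (RtoC 1). rewrite RtoC_minus. ring.
    - assert (EL : (L * Cconj L)%C = 1).
      { rewrite <- Cmod2_conj, HL. f_equal. ring. }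
      unfold g. rewrite <- EL. ring. }
  assert (He : exp (2 * Cmod b / (t / 4)) <= exp 8).
  { assert (X : 2 * Cmod b / (t / 4) <= 8).
    { apply Rmult_le_reg_r with (t / 4); [lra|].
      replace (2 * Cmod b / (t / 4) * (t / 4)) with (2 * Cmod b) by (field; lra). lra. }
    destruct X as [X| ->]; [left; now apply exp_increasing|right; reflexivity]. }
  assert (Hfin : Re (g (stolz_point zeta t k)) <= eps).
  { eapply Rle_trans; [exact Hh|].
    apply Rle_trans with (exp (2 * Cmod b / (t / 4)) * (eps / exp 8)).
    - apply Rmult_le_compat_l; [left; apply exp_pos|exact Ha].
    - replace eps with (exp 8 * (eps / exp 8)) at 2 by (field; lra).
      apply Rmult_le_compat_r; [left; now apply Rdiv_lt_0_compat|exact He]. }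
  (* Now [Re (Cconj L * phi) >= 1 - eps], and the modulus of [phi] is at least that real part. *)
  rewrite Hg in Hfin.
  assert (B := re_le_Cmod (Cconj L * phi (stolz_point zeta t k))).
  rewrite Cmod_mult, Cmod_conj, HL in B. apply Rabs_le_between in B. lra.
Qed.

(** * Comparison of first-order terms and conclusion *)

(** Subtracting the estimates at [delta / 2] and [delta / 4] eliminates [A]; with [eps / 3] this
    leaves exactly [|B| <= eps]. *)
Lemma affine_little_o_slope (A B : R) :
  (forall eps, 0 < eps -> exists delta, 0 < delta /\ forall t, 0 < t < delta ->
     Rabs (A - t * B) <= eps * t) -> B = 0.
Proof.
  intros H. apply Rabs_eq_0, Rle_antisym; [|apply Rabs_pos].
  apply le_epsilon. intros eps Heps. rewrite Rplus_0_l.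
  destruct (H (eps / 3)) as (delta & Hd & HD); [lra|].
  assert (H1 := HD (delta / 2) ltac:(lra)). assert (H2 := HD (delta / 4) ltac:(lra)).
  apply Rabs_le_between in H1. apply Rabs_le_between in H2. apply Rabs_le.
  split; apply Rmult_le_reg_r with delta; lra.
Qed.

Theorem theorem3p8 (phi omega : C -> C) (zeta : C) :
  schwarz_type phi -> schwarz_type omega ->
  Cmod zeta = 1 ->
  (exists L : C, Cmod L = 1 /\ radial_limit phi zeta L) ->
  (forall f : C -> C, class_P f ->
     class_P (T_op (fun z => ell (omega z)) phi f)) ->
  ~ (exists d : C, d <> 0%C /\ angular_derivative omega zeta d).
Proof.
  intros Hphi Homega Hz (L & HL & Hrad) HT
    (d & Hd0 & (eta & Heta & Hlim) & (domega & Hder & Hdlim)).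
  assert (Hmd := Cmod_ge_0 d).
  assert (S : forall k, 0 <= k <= 1 -> Im (d * zeta * (1, k)) = 0).
  { intros k Hk. apply (affine_little_o_slope (Im eta)). intros eps Heps.
    (* The final error is [2 e^2 t + 4 e |d| t] from [Im (omega z)] plus [e t] from [X]. With
       [e <= 1 / 2] it is at most [4 (|d| + 1) e t]; the same bound gives [|phi z| >= 1 / 2]. *)
    set (e := Rmin (eps / (4 * (Cmod d + 1))) (1 / 2)).
    assert (He : 0 < e).
    { apply Rmin_pos; [apply Rdiv_lt_0_compat; lra|lra]. }
    assert (He2 : e <= 1 / 2) by apply Rmin_r.
    assert (He1 : e * (4 * (Cmod d + 1)) <= eps).
    { apply Rle_trans with (eps / (4 * (Cmod d + 1)) * (4 * (Cmod d + 1))).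
      - apply Rmult_le_compat_r; [lra|apply Rmin_l].
      - right; field; lra. }
    destruct (angular_expansion omega domega zeta eta d k Hz Hk Hder Hlim Hdlim e He)
      as (d1 & Hd1 & H1).
    destruct (Cmod_stolz_point_to_1 phi zeta L k Hphi Hz HL Hk Hrad e He)
      as (d2 & Hd2 & H2).
    exists (Rmin d1 d2). split; [apply Rmin_pos; lra|].
    intros t [Ht0 Ht].
    assert (h1 := Rlt_le_trans _ _ _ Ht (Rmin_l _ _)).
    assert (h2 := Rlt_le_trans _ _ _ Ht (Rmin_r _ _)).
    specialize (H1 t (conj Ht0 h1)). specialize (H2 t (conj Ht0 h2)).
    set (z := stolz_point zeta t k) in *.
    assert (Hzd : in_disk z).
    { unfold in_disk. assert (Cmod z <= 1 - t / 2); [apply Cmod_stolz_point; lra|lra]. }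
    assert (Hom := proj1 (proj2 Homega) z Hzd). assert (Hph := proj1 (proj2 Hphi) z Hzd).
    unfold in_disk in Hom, Hph.
    assert (I := Im_omega_le phi omega z Hphi Homega HT Hzd).
    set (X := (omega z - eta + d * zeta * (RtoC t * (1, k)))%C) in *.
    assert (D : Cmod (omega z - eta) <= e * t + 2 * Cmod d * t).
    { replace (omega z - eta)%C with (X + - (d * zeta * (RtoC t * (1, k))))%C
        by (unfold X; ring).
      eapply Rle_trans; [apply Cmod_triangle|].
      rewrite Cmod_opp, !Cmod_mult, Hz, Cmod_R, Rabs_pos_eq by lra.
      assert (Cmod d * 1 * (t * Cmod (1, k)) <= 2 * Cmod d * t); [|lra].
      generalize (Cmod_slope_le k Hk) (Cmod_ge_0 (1, k)). intros.
      replace (2 * Cmod d * t) with (Cmod d * 1 * (t * 2)) by ring.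
      apply Rmult_le_compat_l; [lra|]. apply Rmult_le_compat_l; lra. }
    (* Because [|eta| = 1], the distance of [omega z] to the unit circle is at most
       [|omega z - eta|], which is [O(t)] by the expansion. *)
    assert (T : 1 - Cmod (omega z) <= Cmod (omega z - eta)).
    { rewrite <- Heta at 1. replace eta with (omega z + - (omega z - eta))%C at 1 by ring.
      generalize (Cmod_triangle (omega z) (- (omega z - eta))). rewrite Cmod_opp. lra. }
    assert (Hp0 := Cmod_ge_0 (phi z)). assert (Ho0 := Cmod_ge_0 (omega z)).
    assert (Y1 : 1 - Cmod (omega z) ^ 2 <= 2 * (e * t + 2 * Cmod d * t)) by nra.
    assert (Y2 : 1 - Cmod (phi z) ^ 2 <= 2 * e) by nra.
    assert (Y3 : 2 * Rabs (Im (omega z)) <= 2 * e * (2 * (e * t + 2 * Cmod d * t))).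
    { apply Rle_trans with (4 * Cmod (phi z) * Rabs (Im (omega z))).
      - apply Rmult_le_compat_r; [apply Rabs_pos|lra].
      - eapply Rle_trans; [exact I|]. apply Rmult_le_compat; try assumption; nra. }
    assert (EI : Im eta - t * Im (d * zeta * (1, k)) = Im (omega z) - Im X).
    { unfold X. destruct (omega z), eta, (d * zeta)%C. simpl. ring. }
    rewrite EI. unfold Rminus. eapply Rle_trans; [apply Rabs_triang|].
    rewrite Rabs_Ropp.
    assert (Y4 := im_le_Cmod X).
    apply Rle_trans with (e * (4 * (Cmod d + 1)) * t).
    - assert (e * e * t <= e * (1 / 2) * t).
      { apply Rmult_le_compat_r; [lra|]. apply Rmult_le_compat_l; lra. }
      assert (0 <= e * t) by nra.
      nra.
    - apply Rmult_le_compat_r; lra. }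
  (* With [d * zeta = p + i q] the identity reads [q + k p = 0]: [k = 0] gives [q = 0], then [k = 1]
     gives [p = 0]. *)
  assert (S0 := S 0 ltac:(lra)). assert (S1 := S 1 ltac:(lra)).
  assert (E : (d * zeta)%C = 0).
  { destruct (d * zeta)%C as [p q]. simpl in S0, S1. unfold RtoC. f_equal; lra. }
  apply (f_equal Cmod) in E. rewrite Cmod_mult, Hz, Cmod_0, Rmult_1_r in E.
  now apply Hd0, Cmod_eq_0.
Qed.
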